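(* Let $R=R(A_1,S)$ be an extended affine root system of type $A_1$ with extended affine Weyl group $\mathcal W$, let $\nu$ be the nullity of $R$ and $m=\mathrm{ind}(S)$. If any one of the following statements holds, then $\mathcal W$ has the presentation by conjugation: (i) $m\le\nu+3$; (ii) $\nu\le 3$ and $m\ne 7$; (iii) $\mathrm{Esupp}(S)=\emptyset$. In particular, if $\nu\le 3$, then $\mathcal W$ has the presentation by conjugation if and only if $m\ne 7$.
   Context: Semilattices. Let $\mathcal V^0$ be a finite dimensional real vector space of dimension $\nu$. A semilattice in $\mathcal V^0$ is a subset $S\subseteq\mathcal V^0$ such that $0\in S$, $S\pm 2S\subseteq S$, $S$ spans $\mathcal V^0$ and $S$ is discrete in $\mathcal V^0$. The $\mathbb Z$-span $\Lambda$ of $S$ is a lattice in $\mathcal V^0$ having a $\mathbb Z$-basis contained in $S$; fix such a basis $\{\sigma_1,\ldots,\sigma_\nu\}\subseteq S$. For $J\subseteq J_\nu:=\{1,\ldots,\nu\}$ put $\tau_J:=\sum_{j\in J}\sigma_j$ ($\tau_\emptyset=0$). $\mathrm{supp}(S)$ is the unique collection of subsets of $J_\nu$ with $\emptyset\in\mathrm{supp}(S)$ and $S=\bigcup_{J\in\mathrm{supp}(S)}(\tau_J+2\Lambda)$. Put $\mathrm{Esupp}(S)=\{J\in\mathrm{supp}(S): |J|\ge 3\}$ and $\mathrm{ind}(S)=|\mathrm{supp}(S)|-1$ (the index of $S$). Root system and Weyl group. Let $\mathcal V=\mathbb R\alpha_1\oplus\mathcal V^0$ with the positive semi-definite symmetric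 bilinear form having radical $\mathcal V^0$ and $(\alpha_1,\alpha_1)=2$. The extended affine root system $R=R(A_1,S)$ of type $A_1$ and nullity $\nu$ is $R=(S+S)\cup(\pm\alpha_1+S)$, with $S$ a semilattice in $\mathcal V^0$ (every extended affine root system of type $A_1$ has this form), and $R^\times=\pm\alpha_1+S$ is its set of non-isotropic elements. Let $\tilde{\mathcal V}=\mathcal V\oplus(\mathcal V^0)^*$ with the non-degenerate symmetric form extending that of $\mathcal V$ such that $(\alpha_1,(\mathcal V^0)^* )=((\mathcal V^0)^*,(\mathcal V^0)^* )=0$ and $(\sigma_i,\lambda_j)=\delta_{i,j}$ for a basis $\{\lambda_1,\ldots,\lambda_\nu\}$ of $(\mathcal V^0)^*$. The extended affine Weyl group $\mathcal W$ is the subgroup of the orthogonal group of $\tilde{\mathcal V}$ generated by the reflections $w_\alpha(u)=u-(u,\alpha)\alpha$, $\alpha\in R^\times$. Presentation by conjugation. $\hat{\mathcal W}$ is the group with generators $\hat w_\alpha$, $\alpha\in R^\times$, and relations $\hat w_\alpha^2=1$ and $\hat w_\alpha\hat w_\beta\hat w_\alpha=\hat w_{w_\alpha(\beta)}$ ($\alpha,\beta\in R^\times$). $\mathcal W$ has the presentation by conjugation if $\mathcal W\cong\hat{\mathcal W}$. *)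

(* Defs.v *)
From HB Require Import structures.
From mathcomp Require Import all_boot all_order all_algebra.
From mathcomp Require Import all_classical all_reals all_analysis.
From mathcomp Require Import generic_quotient.

Set Implicit Arguments.
Unset Strict Implicit.
Unset Printing Implicit Defensive.

Import Order.TTheory GRing.Theory Num.Theory.
Import numFieldNormedType.Exports.
Local Open Scope classical_set_scope.
Local Open Scope quotient_scope.
Local Open Scope ring_scope.

Section GeneratedSubgroup.
Variables (G : groupType) (A : set G).

Definition generated_set : set G :=
  smallest (fun H : set G => group_closed (mem H)) A.

Definition generated : Type := set_type generated_set.

HB.instance Definition _ := SubChoice.on generated.

Lemma generated_closed : group_closed (mem generated_set).
Proof.
split=> [|x y].
  by rewrite inE => H [[H1 _] _]; move: H1; rewrite inE.
rewrite !inE => gx gy H HP; case: (HP) => -[_ Hd] _.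
by move: (Hd x y); rewrite !inE; apply; [exact: gx|exact: gy].
Qed.

HB.instance Definition _ :=
  SubChoice_isSubGroup.Build G (mem generated_set) generated generated_closed.

End GeneratedSubgroup.

Section PresentedGroup.
Variable X : choiceType.

(* The letter (x, b) stands for x when b = false, for x^-1 when b = true. *)
Definition gword : Type := seq (X * bool).

Definition gword_inv (w : gword) : gword :=
  rev [seq (l.1, ~~ l.2) | l <- w].

Variable rel : gword -> gword -> Prop.

Inductive gword_eq : gword -> gword -> Prop :=
| gword_eq_refl u : gword_eq u u
| gword_eq_sym u v : gword_eq u v -> gword_eq v u
| gword_eq_trans u v w : gword_eq u v -> gword_eq v w -> gword_eq u w
| gword_eq_cat u u' v v' :
    gword_eq u u' -> gword_eq v v' -> gword_eq (u ++ v) (u' ++ v')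
| gword_eq_cancel x b : gword_eq [:: (x, b); (x, ~~ b)] [::]
| gword_eq_rel u v : rel u v -> gword_eq u v.

Definition gword_eqb (u v : gword) : bool := `[< gword_eq u v >].

Lemma gword_eqb_refl : reflexive gword_eqb.
Proof. by move=> u; apply/asboolP; exact: gword_eq_refl. Qed.

Lemma gword_eqb_sym : symmetric gword_eqb.
Proof. by move=> u v; apply/asboolP/asboolP; exact: gword_eq_sym. Qed.

Lemma gword_eqb_trans : transitive gword_eqb.
Proof.
by move=> v u w /asboolP uv /asboolP vw; apply/asboolP; exact: gword_eq_trans vw.
Qed.

Canonical gword_equiv :=
  EquivRel gword_eqb gword_eqb_refl gword_eqb_sym gword_eqb_trans.

Definition presented : Type := {eq_quot gword_equiv}.
HB.instance Definition _ := Choice.on presented.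
HB.instance Definition _ := EqQuotient.on presented.

Local Notation cl := (\pi_presented)%qT.

Definition presented_mul (x y : presented) : presented :=
  cl (repr x ++ repr y : gword).
Definition presented_inv (x : presented) : presented := cl (gword_inv (repr x)).
Definition presented_one : presented := cl ([::] : gword).

Lemma presented_clP (u v : gword) : gword_eq u v <-> cl u = cl v.
Proof. by split=> [uv|/eqquotP/asboolP//]; apply/eqquotP/asboolP. Qed.

Lemma repr_cl (u : gword) : gword_eq (repr (cl u)) u.
Proof. by apply/presented_clP; rewrite reprK. Qed.

Lemma presented_mulE (u v : gword) : presented_mul (cl u) (cl v) = cl (u ++ v).
Proof. by apply/presented_clP; apply: gword_eq_cat; exact: repr_cl. Qed.

Lemma gword_eqVr (u : gword) : gword_eq (u ++ gword_inv u) [::].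
Proof.
elim: u => [|[x b] u IH]; first exact: gword_eq_refl.
rewrite /gword_inv /= rev_cons -cats1 -/(gword_inv u).
apply: gword_eq_trans (gword_eq_cancel x b).
rewrite -cat1s catA -catA -[[:: _; _]]/([:: (x, b)] ++ [:: (x, ~~ b)]).
apply: gword_eq_cat; first exact: gword_eq_refl.
rewrite catA -[X in gword_eq _ X]cat0s.
by apply: gword_eq_cat => //; exact: gword_eq_refl.
Qed.

Lemma gword_invK : involutive gword_inv.
Proof.
move=> u; rewrite /gword_inv map_rev revK -map_comp.
by rewrite -[RHS]map_id; apply: eq_map => -[x b] /=; rewrite negbK.
Qed.

Lemma gword_eqVl (u : gword) : gword_eq (gword_inv u ++ u) [::].
Proof. by have := gword_eqVr (gword_inv u); rewrite gword_invK. Qed.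

Lemma presented_mulA : associative presented_mul.
Proof.
elim/quotW=> x; elim/quotW=> y; elim/quotW=> z.
by rewrite (presented_mulE y z) (presented_mulE x y) !presented_mulE catA.
Qed.

Lemma presented_mul1 : left_id presented_one presented_mul.
Proof. by elim/quotW=> x; rewrite presented_mulE. Qed.

Lemma presented_1mul : right_id presented_one presented_mul.
Proof. by elim/quotW=> x; rewrite presented_mulE cats0. Qed.

Lemma presented_mulV :
  left_inverse presented_one presented_inv presented_mul.
Proof.
move=> x; rewrite -[X in presented_mul _ X]reprK presented_mulE.
by apply/presented_clP; exact: gword_eqVl.
Qed.

Lemma presented_Vmul :
  right_inverse presented_one presented_inv presented_mul.
Proof.
move=> x; rewrite -[X in presented_mul X _]reprK presented_mulE.
by apply/presented_clP; exact: gword_eqVr.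
Qed.

HB.instance Definition _ := isGroup.Build presented
  presented_mulA presented_mul1 presented_1mul presented_mulV presented_Vmul.

End PresentedGroup.

Definition isomorphic (G H : groupType) : Prop :=
  exists f : {multiplicative G -> H}, bijective f.

Section OrthogonalGroup.
Variables (R : realType) (V : vectType R) (form : V -> V -> R).

Definition orthogonal_set : set 'End(V) :=
  [set f : 'End(V) |
   bijective f /\ forall u v, form (f u) (f v) = form u v].

Definition orthogonal_group : Type := set_type orthogonal_set.
HB.instance Definition _ := SubChoice.on orthogonal_group.

Lemma orthogonal_lker0 (f : orthogonal_group) : lker (val f) == 0%VS.
Proof.
by apply/lker0P; case: f => f /=; rewrite inE => -[/bij_inj].
Qed.

Lemma orthogonal_id : (\1%VF : 'End(V)) \in orthogonal_set.
Proof.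
rewrite inE; split; last by move=> u v; rewrite !lfunE.
by exists id => u; rewrite lfunE.
Qed.

Lemma orthogonal_comp (f g : orthogonal_group) :
  (val f \o val g)%VF \in orthogonal_set.
Proof.
case: f g => f /= /set_mem[bf hf] [g /= /set_mem[bg hg]].
rewrite inE; split; last by move=> u v; rewrite !comp_lfunE hf hg.
apply: (eq_bij (bij_comp bf bg)) => u; by rewrite comp_lfunE.
Qed.

Lemma orthogonal_inv (f : orthogonal_group) : (val f)^-1%VF \in orthogonal_set.
Proof.
have k := orthogonal_lker0 f.
have Kl : cancel (val f) (val f)^-1%VF by exact: lker0_lfunK.
have Kr : cancel (val f)^-1%VF (val f) by exact: lker0_lfunVK.
rewrite inE; split; first by exists (val f).
move=> u v; have /set_mem[_ hf] := valP f.
by rewrite -hf !Kr.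
Qed.

Definition orth_one : orthogonal_group :=
  exist (fun f => f \in orthogonal_set) _ orthogonal_id.
Definition orth_mul (f g : orthogonal_group) : orthogonal_group :=
  exist (fun f => f \in orthogonal_set) _ (orthogonal_comp f g).
Definition orth_inv (f : orthogonal_group) : orthogonal_group :=
  exist (fun f => f \in orthogonal_set) _ (orthogonal_inv f).

Lemma orth_mulA : associative orth_mul.
Proof. by move=> f g h; apply/val_inj; exact: comp_lfunA. Qed.

Lemma orth_mul1 : left_id orth_one orth_mul.
Proof. by move=> f; apply/val_inj; exact: comp_lfun1l. Qed.

Lemma orth_1mul : right_id orth_one orth_mul.
Proof. by move=> f; apply/val_inj; exact: comp_lfun1r. Qed.

Lemma orth_mulV : left_inverse orth_one orth_inv orth_mul.
Proof.
by move=> f; apply/val_inj; apply: lker0_compVf; exact: orthogonal_lker0.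
Qed.

Lemma orth_Vmul : right_inverse orth_one orth_inv orth_mul.
Proof.
by move=> f; apply/val_inj; apply: lker0_compfV; exact: orthogonal_lker0.
Qed.

HB.instance Definition _ := isGroup.Build orthogonal_group
  orth_mulA orth_mul1 orth_1mul orth_mulV orth_Vmul.

End OrthogonalGroup.

Section Semilattice.
Variables (R : realType) (nu : nat).
Local Notation V0 := 'rV[R]_nu.

Definition real_span (S : set V0) : set V0 :=
  [set v | exists n (s : 'I_n -> V0) (c : 'I_n -> R),
    (forall i, S (s i)) /\ v = \sum_i c i *: s i].

Definition int_span (S : set V0) : set V0 :=
  [set v | exists n (s : 'I_n -> V0) (c : 'I_n -> int),
    (forall i, S (s i)) /\ v = \sum_i s i *~ c i].

Definition semilattice (S : set V0) : Prop :=
  [/\ S 0,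
      forall s t, S s -> S t -> S (s + t *+ 2) /\ S (s - t *+ 2),
      real_span S = setT
    & S `<=` isolated S].

(* The rank nu of the integral basis is the dimension of the ambient space. *)
Definition int_basis (L : set V0) (sigma : 'I_nu -> V0) : Prop :=
  L = [set v | exists c : 'I_nu -> int, v = \sum_i sigma i *~ c i] /\
  (forall c : 'I_nu -> int, \sum_i sigma i *~ c i = 0 -> forall i, c i = 0).

Variables (S : set V0) (sigma : 'I_nu -> V0).

Definition tau (J : {set 'I_nu}) : V0 := \sum_(j in J) sigma j.

Definition is_supp (T : {set {set 'I_nu}}) : Prop :=
  finset.set0 \in T /\
  S = \bigcup_(J in [set` T]) [set tau J + l *+ 2 | l in int_span S].

(* The unique T satisfying is_supp, for S a semilattice and sigma an integral
   basis of int_span S contained in S. *)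
Definition supp : {set {set 'I_nu}} := xget finset.set0 [set T | is_supp T].

Definition Esupp : {set {set 'I_nu}} :=
  [set J in supp | (3 <= #|J|)%N]%SET.

Definition ind : nat := (#|supp| - 1)%N.

End Semilattice.

Section RootSystem.
Variables (R : realType) (nu : nat).
Local Notation V0 := 'rV[R]_nu.

(* ((a, x), l) stands for a alpha_1 + x + l. The space V is identified with
   the vectors such that l = 0. *)
Definition Vtilde : Type := ((R^o * V0) * 'Hom(V0, R^o))%type.
HB.instance Definition _ := Vector.on Vtilde.

(* V0 and its dual are paired by evaluation, so that the basis (lambda_j) dual
   to any basis (sigma_i) satisfies (sigma_i, lambda_j) = delta_ij. *)
Definition bform (u v : Vtilde) : R :=
  2 * u.1.1 * v.1.1 + (v.2 u.1.2 + u.2 v.1.2).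

Definition alpha1 : Vtilde := ((1, 0), 0).

Definition inV0 (x : V0) : Vtilde := ((0, x), 0).

Definition earA1_roots (S : set V0) : set Vtilde :=
  [set a | exists s t, [/\ S s, S t & a = inV0 (s + t)]] `|`
  [set a | exists s, S s /\ (a = alpha1 + inV0 s \/ a = - alpha1 + inV0 s)].

Definition nonisotropic_roots (S : set V0) : set Vtilde :=
  [set a | earA1_roots S a /\ bform a a <> 0].

Definition reflection (a u : Vtilde) : Vtilde := u - bform u a *: a.

Variable S : set V0.

Definition root_reflections : set (orthogonal_group bform) :=
  [set w | exists2 a, nonisotropic_roots S a &
           forall u, (val w : 'End(Vtilde)) u = reflection a u].

Definition weyl_group : groupType := generated root_reflections.

Definition hat_gen (a : nonisotropic_roots S) :
  nonisotropic_roots S * bool := (a, false).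

(* The condition on c identifies it with w_a(b), which is again a nonisotropic
   root when S is a semilattice. *)
Inductive conjugation_rel :
  gword (nonisotropic_roots S) -> gword (nonisotropic_roots S) -> Prop :=
| conj_rel_square a : conjugation_rel [:: hat_gen a; hat_gen a] [::]
| conj_rel_conj a b c : val c = reflection (val a) (val b) ->
    conjugation_rel [:: hat_gen a; hat_gen b; hat_gen a] [:: hat_gen c].

Definition hat_weyl_group : groupType := presented conjugation_rel.

Definition presentation_by_conjugation : Prop :=
  isomorphic weyl_group hat_weyl_group.

End RootSystem.

(* Main.v *)
From HB Require Import structures.
Require Import Defs.
From mathcomp Require Import all_boot all_order all_algebra.
From mathcomp Require Import all_classical all_reals all_analysis.
From mathcomp Require Import ring lra zify.

(* Write x_s for the generator of the presented group attached to alpha_1 + s,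
   s in S; the generator of -(alpha_1 + s) is the same. The relations become
   x_s^2 = 1 and x_s x_t x_s = x_{2s-t}. Put y_s = x_s x_0 and y_i = y_{sigma_i}.
   The elements c_ij = [y_i, y_j] and
   z_P = y_{tau_P} (prod_{i in P} y_i)^-1, P in supp(S), are central, because
   conjugation by them translates every root by 0, and conjugating z_P by x_0
   shows that z_P^2 is a product of c_ij's. Hence each element has the form
   (prod_i y_i^{n_i}) (prod c_ij^{N_ij} prod z_P^{E_P}) x_0^b. In the Weyl group
   c_ij acts as 2 sigma_i /\ sigma_j and z_P as - sum_{i<j in P} sigma_i /\ sigma_j,
   so an element acting trivially has n = 0, b = 0 and 2 N_ij = sum_{P > i,j} E_P:
   the P with E_P odd cover every pair an even number of times. If the members
   of supp(S) with at least two elements contain no nonempty family with this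
   property, the presented group is the Weyl group. Such a family has at least
   four members, and, together with the empty set and the singletons, this makes
   ind(S) >= nu + 4.

   Conversely, for nu = 3 and m = 7 the support consists of all eight subsets.
   The abelianization of the presented group is (Z/2)^8, but in the Weyl group
   w_0 w_a w_{a+b} w_b = w_c w_{a+c} w_{a+b+c} w_{b+c}, whose two sides involve
   each of the eight classes once; hence the Weyl group has no epimorphism onto
   (Z/2)^8. *)

Set Implicit Arguments.
Unset Strict Implicit.
Unset Printing Implicit Defensive.

Import Order.TTheory GRing.Theory Num.Theory.
Local Open Scope ring_scope.

(** * Families of sets covering every pair evenly *)

Section EvenCover.
Variables (I : finType).
Implicit Types (D T : {set {set I}}) (P Q : {set I}).

(* Every pair of points lies in an even number of members of [D]: the
   characteristic vectors of the pairs inside the members sum to zero mod 2. *)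
Definition evenly_covers D : Prop := forall i j : I, i != j ->
  ~~ odd #|[set P in D | (i \in P) && (j \in P)]|.

Lemma evenly_covers_other D P i j : evenly_covers D -> P \in D ->
  i != j -> i \in P -> j \in P ->
  exists Q, [/\ Q \in D, Q != P, i \in Q & j \in Q].
Proof.
move=> eD PD ij iP jP.
pose A := [set Q in D | (i \in Q) && (j \in Q)].
have oA := eD i j ij : ~~ odd #|A|.
have PA : P \in A by rewrite inE PD iP.
have : (0 < #|A :\ P|)%N by move: oA; rewrite (cardsD1 P A) PA /=; case: #|_|.
by case/card_gt0P => Q; rewrite !inE => /and3P[QP QD /andP[iQ jQ]]; exists Q.
Qed.

(** Take [P] of maximal size and a pair [i], [j] in it, covered again by [Q]. Maximality leaves some
    [k] of [P] outside [Q], and the pair [i], [k] yields a third member [Q']. Without a fourth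
    member the pair [j], [k] forces [j] into [Q'], so [i], [j] is covered three times, which is
    odd. *)
Lemma evenly_covers_card D : evenly_covers D ->
  (forall P, P \in D -> (1 < #|P|)%N) -> D != finset.set0 -> (3 < #|D|)%N.
Proof.
move=> eD D2 /set0Pn[P0 P0D]; rewrite ltnNge; apply/negP => D3.
have [P PD Pmax] := arg_maxnP (fun P : {set I} => #|P|) P0D.
have /card_gt1P[i [j [iP jP ij]]] := D2 P PD.
have [Q [QD QP iQ jQ]] := evenly_covers_other eD PD ij iP jP.
have /subsetPn[k kP kQ] : ~~ (P \subset Q).
  apply: contra QP => PQ; rewrite eq_sym eqEcard PQ; exact: Pmax.
have ik : i != k by apply: contraNneq kQ => <-.
have jk : j != k by apply: contraNneq kQ => <-.
have [Q' [Q'D Q'P iQ' kQ']] := evenly_covers_other eD PD ik iP kP.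
have QQ' : Q != Q' by apply: contraNneq kQ => ->.
have DE : D = [set P; Q; Q'].
  apply/esym/eqP; rewrite eqEcard; apply/andP; split.
    by apply/fintype.subsetP => A; rewrite !inE => /orP[/orP[]|] /eqP ->.
  apply: leq_trans D3 _; rewrite finset.setUC cardsU1 cards2 !inE.
  by rewrite (negbTE Q'P) eq_sym (negbTE QQ') eq_sym (negbTE QP).
have jQ' : j \in Q'.
  have [A [AD AP jA kA]] := evenly_covers_other eD PD jk jP kP.
  move: AD; rewrite DE !inE (negbTE AP) /= => /orP[] /eqP AE; last by rewrite -AE.
  by move: kQ; rewrite -AE kA.
have := eD i j ij; rewrite (_ : [set _ in D | _] = D); last first.
  by apply/setP => A; rewrite !inE andb_idr // DE !inE => /orP[/orP[]|] /eqP ->;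
    rewrite ?iP ?jP ?iQ ?jQ ?iQ' ?jQ'.
rewrite DE finset.setUC cardsU1 cards2 !inE.
by rewrite (negbTE Q'P) [Q' == Q]eq_sym (negbTE QQ') [P == Q]eq_sym (negbTE QP).
Qed.

Lemma evenly_covers_large D : evenly_covers D ->
  evenly_covers [set P in D | (1 < #|P|)%N].
Proof.
move=> eD i j ij.
rewrite (_ : [set _ in _ | _] = [set P in D | (i \in P) && (j \in P)]).
  exact: eD.
apply/setP => P; rewrite !inE -andbA; congr (_ && _); rewrite andb_idl //.
by move=> /andP[iP jP]; apply/card_gt1P; exists i, j.
Qed.

(** Otherwise the empty set, the [#|I|] singletons and at least four larger members of [D] give [T]
    at least [#|I| + 5] members. *)
Lemma evenly_covers_small T D : finset.set0 \in T -> (forall i, [set i] \in T) ->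
  (#|T| <= #|I| + 4)%N -> D \subset T -> evenly_covers D ->
  forall P, P \in D -> (#|P| < 2)%N.
Proof.
move=> T0 T1 cT DT eD P PD; rewrite ltnNge; apply/negP => P2.
set D' := [set P in D | (1 < #|P|)%N].
have D'4 : (3 < #|D'|)%N.
  apply: evenly_covers_card; first exact: evenly_covers_large.
    by move=> Q; rewrite inE => /andP[].
  by apply/set0Pn; exists P; rewrite inE PD.
set U := finset.set0 |: [set [set i] | i : I].
have cU : #|U| = #|I|.+1.
  rewrite cardsU1 card_imset; last exact: set1_inj.
  rewrite (_ : _ \notin _) //; apply/imsetP => -[i _ /setP/(_ i)].
  by rewrite !inE eqxx.
have : (#|U :|: D'| <= #|T|)%N.
  apply: subset_leq_card; apply/fintype.subsetP => A.
  rewrite !inE => /orP[/orP[/eqP ->//|/imsetP[i _ ->]//]|/andP[AD _]].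
  exact: (fintype.subsetP DT).
have UD' : U :&: D' = finset.set0.
  apply/setP => A; rewrite !inE.
  apply/negbTE/negP => /andP[/orP[/eqP ->|/imsetP[i _ ->]]].
    by rewrite cards0 andbF.
  by rewrite cards1 andbF.
rewrite cardsU UD' cards0 cU subn0 => /leq_trans/(_ cT).
by rewrite addSnnS leq_add2l ltnS leqNgt D'4.
Qed.

(** A set of at most two points containing [i != j] is [[set i; j]], so no pair is covered twice. *)
Lemma evenly_covers_pairs T D : (forall P, P \in T -> (#|P| < 3)%N) ->
  D \subset T -> evenly_covers D -> forall P, P \in D -> (#|P| < 2)%N.
Proof.
move=> T3 DT eD P PD; rewrite ltnNge; apply/negP => P2.
have /card_gt1P[i [j [iP jP ij]]] := P2.
have [Q [QD QP iQ jQ]] := evenly_covers_other eD PD ij iP jP.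
have E A : A \in D -> i \in A -> j \in A -> [set i; j] = A.
  move=> AD iA jA; apply/eqP; rewrite eqEcard cards2 ij.
  rewrite -ltnS T3 ?(fintype.subsetP DT) // andbT.
  by apply/fintype.subsetP => k; rewrite !inE => /orP[] /eqP ->.
by move: QP; rewrite -(E P) // -(E Q) // eqxx.
Qed.

End EvenCover.

(** * The center as an abelian group, integer powers *)

Section Center.
Variable G : groupType.

Definition central_pred : {pred G} := [pred g | `[< forall h : G, (g * h = h * g)%g >]].

Lemma centralP (g : G) : reflect (forall h : G, (g * h = h * g)%g) (g \in central_pred).
Proof. exact: (@asboolP (forall h : G, (g * h = h * g)%g)). Qed.

Definition center : Type := {g : G | g \in central_pred}.
HB.instance Definition _ := SubChoice.on center.

Lemma central1 : (1%g : G) \in central_pred.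
Proof. by apply/centralP => h; rewrite mul1g mulg1. Qed.

Lemma centralM (g h : G) :
  g \in central_pred -> h \in central_pred -> (g * h)%g \in central_pred.
Proof.
move=> /centralP cg /centralP ch; apply/centralP => k.
by rewrite -mulgA (ch k) mulgA (cg k) -mulgA.
Qed.

Lemma centralV (g : G) : g \in central_pred -> (g^-1)%g \in central_pred.
Proof.
by move=> /centralP cg; apply/centralP => k; apply/esym/commuteV/esym/cg.
Qed.

(** The center is written additively, so that its products become sums with integer multiples. *)
Definition center_add (x y : center) : center :=
  Sub (val x * val y)%g (centralM (valP x) (valP y)).
Definition center_opp (x : center) : center := Sub (val x)^-1%g (centralV (valP x)).
Definition center_zero : center := Sub 1%g central1.

Lemma center_addA : associative center_add.
Proof. by move=> x y z; apply/val_inj/mulgA. Qed.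
Lemma center_addC : commutative center_add.
Proof. by move=> x y; apply/val_inj; exact: (centralP _ (valP x)). Qed.
Lemma center_add0 : left_id center_zero center_add.
Proof. by move=> x; apply/val_inj/mul1g. Qed.
Lemma center_addN : left_inverse center_zero center_opp center_add.
Proof. by move=> x; apply/val_inj/mulVg. Qed.

HB.instance Definition _ := GRing.isZmodule.Build center
  center_addA center_addC center_add0 center_addN.

Lemma val_centerD (x y : center) : val (x + y) = (val x * val y)%g.
Proof. by []. Qed.
Lemma val_centerN (x : center) : val (- x) = (val x)^-1%g.
Proof. by []. Qed.
Lemma val_center0 : val (0 : center) = 1%g.
Proof. by []. Qed.

End Center.

Lemma odd_abszD (m n : int) : odd `|(m + n)%R|%N = odd `|m|%N (+) odd `|n|%N.
Proof. by rewrite -oddD; lia. Qed.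

Section IntPower.
Variable G : groupType.
Local Open Scope group_scope.

Definition expgz (g : G) (n : int) : G :=
  match n with Posz k => g ^+ k | Negz k => g ^- k.+1 end.

Lemma expgzS (g : G) n : g * expgz g n = expgz g (n + 1)%R.
Proof.
case: n => [k|[|k]]; first by rewrite -PoszD addn1 /= expgS.
  by rewrite /= expg1 mulgV.
have -> : (Negz k.+1 + 1)%R = Negz k by lia.
by rewrite /= [in LHS]expgSr invgM mulVKg.
Qed.

Lemma expgz_conj (g h : G) n : expgz g n ^ h = expgz (g ^ h) n.
Proof. by case: n => k /=; rewrite ?conjVg conjXg. Qed.

Lemma expgzV (g : G) n : expgz g^-1 n = expgz g (- n)%R.
Proof.
case: n => [[|k]|k]; first by rewrite oppr0.
  by rewrite -NegzE /= expVgn.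
by rewrite NegzE opprK /= expVgn invgK.
Qed.

End IntPower.

(** * Induction along a lattice and evaluation of functionals *)

Lemma lattice_ind (U : zmodType) n (sigma : 'I_n -> U) (A : U -> Prop) :
  (forall i v, A v -> A (v + sigma i *+ 2) /\ A (v - sigma i *+ 2)) ->
  forall (c : 'I_n -> int) v, A v -> A (v + (\sum_i sigma i *~ c i) *+ 2).
Proof.
(* First multiples of a single [sigma i]; then the sum is absorbed one summand at a time. *)
move=> Ash c; have step i m : forall v, A v -> A (v + sigma i *~ m *+ 2).
  case: m => k; elim: k => [|k IH] v Av.
  - by rewrite mul0rn addr0.
  - by rewrite -pmulrn [_ *+ k.+1]mulrSr mulrnDl addrA; case: (Ash i _ (IH _ Av)).
  - by rewrite NegzE mulrNz mulNrn; case: (Ash i _ Av).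
  - have := IH _ Av; rewrite !NegzE !mulrNz !mulNrn -!pmulrn => /(Ash i)[_ h].
    by rewrite [_ *+ k.+2]mulrSr mulrnDl opprD addrA; exact: h.
elim: (index_enum _) => [|i r IH] v Av; first by rewrite big_nil mul0rn addr0.
by rewrite big_cons mulrnDl addrA; exact/IH/step.
Qed.

Section Evaluation.
Variables (R : realType) (nu : nat).
Implicit Types (f : 'Hom('rV[R]_nu, R^o)) (v w : 'rV[R]_nu).

(* Forgets the regular-module structure of the codomain, for [ring]. *)
Definition ev f v : R := f v.

Lemma evD f v w : ev f (v + w) = ev f v + ev f w.
Proof. by rewrite /ev linearD. Qed.
Lemma evN f v : ev f (- v) = - ev f v.
Proof. by rewrite /ev linearN. Qed.
Lemma evZ f e v : ev f (e *: v) = e * ev f v.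
Proof. by rewrite /ev linearZ. Qed.
Lemma ev0 f : ev f 0 = 0.
Proof. by rewrite /ev linear0. Qed.
Lemma ev0l v : ev 0 v = 0.
Proof. by rewrite /ev lfunE. Qed.
Lemma evMz f v n : ev f (v *~ n) = ev f v *~ n.
Proof. by rewrite /ev raddfMz. Qed.
Lemma ev_sum f I (r : seq I) P (F : I -> 'rV[R]_nu) :
  ev f (\sum_(i <- r | P i) F i) = \sum_(i <- r | P i) ev f (F i).
Proof. by rewrite /ev linear_sum. Qed.

End Evaluation.

(** * Coordinates on products of reflections *)

Section Acts.
Variables (R : realType) (nu : nat) (G : groupType).
Local Notation V0 := 'rV[R]_nu.
Local Notation V := (Vtilde R nu).
Variable rho : G -> V -> V.
Hypothesis rho1 : forall u, rho 1%g u = u.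
Hypothesis rhoM : forall g h u, rho (g * h)%g u = rho g (rho h u).

Implicit Types (p q : V0) (f : 'Hom(V0, R^o)) (om : 'Hom(V0, R^o) -> V0).

(* The shape of a product of reflections acting on (a, v, f): [e] is its sign
   and [p] its translation part; [om] is normalized to vanish on reflections. *)
Definition acts (e : R) p om (g : G) : Prop := forall a v f,
  rho g ((a, v), f) =
  ((e * a + ev f p, v - (2 * e * a) *: p + (om f - ev f p *: p)), f).

(** The bivector $p\wedge q$ as a skew map from the dual space to [V0]. *)
Definition wedge p q f : V0 := ev f p *: q - ev f q *: p.

Lemma acts1 : acts 1 0 (fun=> 0) 1%g.
Proof.
by move=> a v f; rewrite rho1 ev0 mul1r addr0 scaler0 scale0r !subr0 addr0.
Qed.

(** The quadratic terms [ev f p *: p] are not additive under composition; the discrepancy of their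
    cross terms is [e *: wedge p p' f]. *)
Lemma actsM e p om e' p' om' g h : e ^+ 2 = 1 ->
  acts e p om g -> acts e' p' om' h ->
  acts (e * e') (p + e *: p') (fun f => om f + om' f + e *: wedge p p' f) (g * h)%g.
Proof.
move=> e2 ag ah a v f; rewrite rhoM ah ag !evD !evZ; congr (_, _, _); first by ring.
rewrite /wedge; apply/rowP => k; rewrite !mxE.
by move/eqP: e2; rewrite sqrf_eq1 => /orP[] /eqP ->; ring.
Qed.

Lemma eq_acts e p om e' p' om' g : acts e p om g -> e = e' -> p = p' -> om =1 om' ->
  acts e' p' om' g.
Proof. by move=> ag <- <- eom a v f; rewrite ag eom. Qed.

Lemma actsM1 p om p' om' g h : acts 1 p om g -> acts 1 p' om' h ->
  acts 1 (p + p') (fun f => om f + om' f + wedge p p' f) (g * h)%g.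
Proof.
move=> ag ah; apply: eq_acts (actsM (expr1n _ _) ag ah) _ _ _.
- by rewrite mulr1.
- by rewrite scale1r.
- by move=> f; rewrite scale1r.
Qed.

Lemma actsV p om g : acts 1 p om g -> acts 1 (- p) (fun f => - om f) g^-1%g.
Proof.
move=> ag a v f.
set u' := (X in _ = X).
suff <- : rho g u' = ((a, v), f) by rewrite -rhoM mulVg rho1.
rewrite /u' ag !evN; congr (_, _, _); first by ring.
by apply/rowP => k; rewrite !mxE; ring.
Qed.

Lemma acts_id e p om g : acts e p om g -> (forall u, rho g u = u) ->
  [/\ e = 1, p = 0 & forall f, om f = 0].
Proof.
move=> ag gid.
(* Testing on [alpha1] gives [e = 1] and $om(0)=2p$; since [om] is not assumed linear, $om(0)=0$
   comes from a separate test on the zero vector. *)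
have := gid ((1, 0), 0); rewrite ag ev0l addr0 mulr1 => -[e1].
rewrite scale0r subr0 => h.
have om0 : om 0 = 0.
  by have := gid ((0, 0), 0); rewrite ag ev0l !mulr0 !scale0r !subr0 !add0r => -[].
have p0 : p = 0.
  by apply/rowP => k; move/rowP/(_ k): h; rewrite om0 e1 !mxE => h; lra.
split=> // f; have := gid ((0, 0), f).
by rewrite ag p0 ev0 !mulr0 !scaler0 !subr0 !add0r => -[].
Qed.

Lemma acts_addl om om' g h : acts 1 0 om g -> acts 1 0 om' h ->
  acts 1 0 (fun f => om f + om' f) (g * h)%g.
Proof.
move=> ag ah; apply: eq_acts (actsM1 ag ah) _ _ _; rewrite ?addr0 //.
by move=> f; rewrite /wedge ev0 !scale0r subrr addr0.
Qed.

Lemma acts_mulz om (z : center G) n : acts 1 0 om (val z) ->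
  acts 1 0 (fun f => om f *~ n) (val (z *~ n)).
Proof.
move=> az; have aN k : acts 1 0 (fun f => om f *+ k) (val (z *+ k)).
  elim: k => [|k IH]; first by rewrite mulr0n; exact: acts1.
  rewrite mulrS val_centerD; apply: eq_acts (acts_addl az IH) _ _ _ => // f.
  by rewrite mulrS.
case: n => k; first exact: aN.
rewrite NegzE mulrNz val_centerN.
by apply: eq_acts (actsV (aN k.+1)) _ _ _; rewrite ?oppr0 // => f; rewrite mulrNz.
Qed.

Lemma acts_sum I (r : seq I) (P : pred I) (om : I -> 'Hom(V0, R^o) -> V0)
    (z : I -> center G) : (forall i, P i -> acts 1 0 (om i) (val (z i))) ->
  acts 1 0 (fun f => \sum_(i <- r | P i) om i f) (val (\sum_(i <- r | P i) z i)).
Proof.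
move=> az; elim: r => [|i r IH].
  by rewrite big_nil; apply: eq_acts acts1 _ _ _ => // f; rewrite big_nil.
rewrite big_cons; case: ifP => Pi; last first.
  by apply: eq_acts IH _ _ _ => // f; rewrite big_cons Pi.
apply: eq_acts (acts_addl (az i Pi) IH) _ _ _ => // f.
by rewrite big_cons Pi.
Qed.

End Acts.

(** * Normal forms in the presented group *)

Section Kernel.
Variables (R : realType) (nu : nat) (G : groupType).
Local Notation V0 := 'rV[R]_nu.
Local Notation V := (Vtilde R nu).
Local Notation I := 'I_nu.
(* [x s] stands for the generator of alpha_1 + s, [rho] for the action through
   the Weyl group, [T] for the support and [lam] for the basis dual to [sigma]. *)
Variables (S : set V0) (sigma : I -> V0) (lam : I -> 'Hom(V0, R^o)).
Variables (T : {set {set I}}) (x : V0 -> G) (rho : G -> V -> V).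

Hypothesis S0 : S 0.
Hypothesis SD : forall s t, S s -> S t -> S (s + t *+ 2) /\ S (s - t *+ 2).
Hypothesis Ssigma : forall i, S (sigma i).
Hypothesis lamE : forall i j, ev (lam i) (sigma j) = (i == j)%:R.
Hypothesis ST : forall P, P \in T -> S (tau sigma P).
Hypothesis Sdec : forall s, S s ->
  exists2 P, P \in T &
    exists c : I -> int, s = tau sigma P + (\sum_i sigma i *~ c i) *+ 2.

Hypothesis rho1 : forall u, rho 1%g u = u.
Hypothesis rhoM : forall g h u, rho (g * h)%g u = rho g (rho h u).
Hypothesis xx : forall s, S s -> (x s * x s)%g = 1%g.
Hypothesis xJ : forall s t, S s -> S t -> (x s * x t * x s)%g = x (s *+ 2 - t).
Hypothesis xind : forall Q : G -> Prop, Q 1%g ->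
  (forall s g, S s -> Q g -> Q (x s * g)%g) -> forall g, Q g.
Hypothesis actsx : forall s, S s -> acts rho (- 1) (- s) (fun=> 0) (x s).

Local Notation y s := (x s * x 0)%g.
Local Notation acts := (acts rho).

Lemma S_opp t : S t -> S (- t).
Proof. by move=> St; have [_] := SD St St; rewrite mulr2n opprD addNKr. Qed.

Lemma x_swap s t : S s -> S t -> (x s * x t)%g = (x (s *+ 2 - t) * x s)%g.
Proof. by move=> Ss St; rewrite -xJ // -!mulgA xx // mulg1. Qed.

Lemma x0V : (x 0)^-1%g = x 0.
Proof. by apply: mulg1_eq; exact: xx. Qed.

Lemma y0 : y 0 = 1%g.
Proof. exact: xx. Qed.

Lemma y_x0 s : (y s * x 0)%g = x s.
Proof. by rewrite -mulgA xx // mulg1. Qed.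

Lemma y_conj s : S s -> (y s ^ x 0)%g = (y s)^-1%g.
Proof.
move=> Ss; apply/esym/mulg1_eq.
by rewrite conjgE x0V y_x0 !mulgA y_x0 xx.
Qed.

(* Conjugation by [g] acts on the generators as translation by [l]. *)
Definition translates (g : G) (l : V0) : Prop := forall t, S t ->
  [/\ S (l + t), S (t - l) & (g * x t)%g = (x (l + t) * g)%g].

(** $x_s x_0 x_t = x_s x_{-t} x_0 = x_{2s+t} x_s x_0$. *)
Lemma translates_y s : S s -> translates (y s) (s *+ 2).
Proof.
move=> Ss t St; have SNt := S_opp St.
split; first by rewrite addrC; case: (SD St Ss).
  by case: (SD St Ss).
by rewrite -mulgA (x_swap S0 St) mul0rn sub0r mulgA (x_swap Ss SNt) opprK mulgA.
Qed.

Lemma translates1 : translates 1%g 0.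
Proof. by move=> t St; rewrite add0r subr0 mul1g mulg1. Qed.

Lemma translatesM g h l m :
  translates g l -> translates h m -> translates (g * h)%g (l + m).
Proof.
move=> gl hm t St; have [Sm _ eh] := hm t St; have [Sl _ eg] := gl _ Sm.
have [_ Stl _] := gl _ St; have [_ Stlm _] := hm _ Stl.
split; [by rewrite -addrA | by rewrite opprD addrA|].
by rewrite -mulgA eh mulgA eg -addrA mulgA.
Qed.

(** The clause [S (t - l)] allows the commutation of [g] to be applied at [t - l]. *)
Lemma translatesV g l : translates g l -> translates g^-1%g (- l).
Proof.
move=> gl t St; have [Sl St1 _] := gl t St; have [_ _ e] := gl _ St1.
split; [by rewrite addrC|by rewrite opprK addrC|].
move: e; rewrite [l + _]addrC subrK => e.
by rewrite [- l + t]addrC -[x t](mulgK g) -e -!mulgA mulKg.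
Qed.

Lemma translates0_central g : translates g 0 -> g \in @central_pred G.
Proof.
move=> g0; apply/centralP; apply: xind => [|s h Ss gh]; first by rewrite mulg1 mul1g.
by have [_ _] := g0 s Ss; rewrite add0r mulgA => ->; rewrite -mulgA gh mulgA.
Qed.

(** * Commutators and defects in the center *)

Local Notation ZG := (center G).
Local Notation yi i := (y (sigma i)).

(** The default 0 of [insubd] is never taken, since the translations of the four factors cancel; for
    [defect] the same holds once [P] lies in [T]. *)
Definition comm_elt (p : I * I) : ZG :=
  insubd (0 : ZG) (yi p.1 * yi p.2 / yi p.1 / yi p.2)%g.
Definition prod_y (r : seq I) : G := (\prod_(i <- r) yi i)%g.
Definition defect (P : {set I}) : ZG :=
  insubd (0 : ZG) (y (tau sigma P) / prod_y (enum P))%g.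

Lemma val_comm_elt i j : val (comm_elt (i, j)) = (yi i * yi j / yi i / yi j)%g.
Proof.
rewrite insubdK //; apply: translates0_central.
have ti := translates_y (Ssigma i); have tj := translates_y (Ssigma j).
have := translatesM (translatesM (translatesM ti tj) (translatesV ti)) (translatesV tj).
by rewrite addrAC addrK addrN.
Qed.

Lemma translates_prod_y r : translates (prod_y r) ((\sum_(i <- r) sigma i) *+ 2).
Proof.
rewrite /prod_y; elim: r => [|i r IH].
  by rewrite !big_nil mul0rn; exact: translates1.
by rewrite !big_cons mulrnDl; apply: translatesM IH; apply: translates_y.
Qed.

Lemma val_defect P : P \in T -> val (defect P) = (y (tau sigma P) / prod_y (enum P))%g.
Proof.
move=> PT; rewrite insubdK //; apply: translates0_central.
have := translatesM (translates_y (ST PT)) (translatesV (translates_prod_y (enum P))).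
by rewrite big_enum subrr.
Qed.

Lemma comm_elt_anti i j : comm_elt (j, i) = - comm_elt (i, j).
Proof.
by apply/val_inj; rewrite val_centerN !val_comm_elt !invgM !invgK !mulgA.
Qed.

Lemma comm_elt_diag i : comm_elt (i, i) = 0.
Proof. by apply/val_inj; rewrite val_comm_elt mulgK mulgV. Qed.

(** Keeping only increasing pairs removes the antisymmetry, so that the coefficients can be read off
    the action. *)
Definition comm_span (z : ZG) : Prop := exists N : I * I -> int,
  z = \sum_(p : I * I | (p.1 < p.2)%N) comm_elt p *~ N p.

Lemma comm_span0 : comm_span 0.
Proof. by exists (fun=> 0); rewrite big1. Qed.

Lemma comm_spanD z z' : comm_span z -> comm_span z' -> comm_span (z + z').
Proof.
move=> [N ->] [N' ->]; exists (fun p => N p + N' p).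
by rewrite -big_split; apply: eq_bigr => p _; rewrite mulrzDr.
Qed.

Lemma comm_spanMz z n : comm_span z -> comm_span (z *~ n).
Proof.
move=> [N ->]; exists (fun p => N p * n).
by rewrite mulrz_suml; apply: eq_bigr => p _; rewrite mulrzA.
Qed.

Lemma comm_span_elt i j : comm_span (comm_elt (i, j)).
Proof.
wlog ij : i j / (i < j)%N => [H|].
  have [/H//|/H h|/val_inj ->] := ltngtP i j; last first.
    by rewrite comm_elt_diag; exact: comm_span0.
  by rewrite comm_elt_anti -mulrN1z; exact: comm_spanMz.
exists (fun p => (p == (i, j))%:R); rewrite (bigD1 (i, j)) //= eqxx mulr1z.
by rewrite big1 ?addr0 // => p /andP[_ /negbTE ->]; rewrite mulr0z.
Qed.

Definition defect_span (z : ZG) : Prop := exists (z1 : ZG) (E : {set I} -> int),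
  comm_span z1 /\ z = z1 + \sum_(P in T) defect P *~ E P.

Lemma defect_span0 : defect_span 0.
Proof.
by exists 0, (fun=> 0); split; [exact: comm_span0 | rewrite big1 ?addr0].
Qed.

Lemma defect_spanD z z' : defect_span z -> defect_span z' -> defect_span (z + z').
Proof.
move=> [z1 [E [h ->]]] [z1' [E' [h' ->]]]; exists (z1 + z1'), (fun P => E P + E' P).
split; first exact: comm_spanD.
by rewrite addrACA -big_split; congr (_ + _); apply: eq_bigr => P _; rewrite mulrzDr.
Qed.

Lemma defect_spanN z : defect_span z -> defect_span (- z).
Proof.
move=> [z1 [E [h ->]]]; exists (- z1), (fun P => - E P).
split; first by rewrite -mulrN1z; exact: comm_spanMz.
by rewrite opprD -sumrN; congr (_ + _); apply: eq_bigr => P _; rewrite mulrNz.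
Qed.

Lemma defect_span_comm z : comm_span z -> defect_span z.
Proof. by exists z, (fun=> 0); split=> //; rewrite big1 ?addr0. Qed.

Lemma defect_span_elt P : P \in T -> defect_span (defect P).
Proof.
move=> PT; exists 0, (fun P' => (P' == P)%:R); split; first exact: comm_span0.
rewrite add0r (bigD1 P) //= eqxx mulr1z.
by rewrite big1 ?addr0 // => p /andP[_ /negbTE ->]; rewrite mulr0z.
Qed.

(** * Congruence modulo the span of commutators and defects *)

Definition eqm (g h : G) : Prop := exists2 z, defect_span z & g = (h * val z)%g.

Lemma eqm_refl g : eqm g g.
Proof. by exists 0; [exact: defect_span0 | rewrite mulg1]. Qed.

Lemma eqm_sym g h : eqm g h -> eqm h g.
Proof.
by move=> [z Kz ->]; exists (- z); [exact: defect_spanN | rewrite mulgK].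
Qed.

Lemma eqm_trans h g k : eqm g h -> eqm h k -> eqm g k.
Proof.
move=> [z Kz ->] [z' Kz' ->]; exists (z' + z); first exact: defect_spanD.
by rewrite mulgA.
Qed.

Lemma eqmM g g' h h' : eqm g g' -> eqm h h' -> eqm (g * h)%g (g' * h')%g.
Proof.
move=> [z Kz ->] [z' Kz' ->]; exists (z + z'); first exact: defect_spanD.
have /centralP cz := valP z.
by rewrite val_centerD !mulgA -[(g' * val z * h')%g]mulgA (cz h') !mulgA.
Qed.

Lemma eqmMl g h h' : eqm h h' -> eqm (g * h)%g (g * h')%g.
Proof. by apply: eqmM; exact: eqm_refl. Qed.

Lemma eqmMr g g' h : eqm g g' -> eqm (g * h)%g (g' * h)%g.
Proof. by move/eqmM; apply; exact: eqm_refl. Qed.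

Definition commutes_mod (g h : G) : Prop := eqm (g * h)%g (h * g)%g.

Lemma commutes_modM g g' h :
  commutes_mod g h -> commutes_mod g' h -> commutes_mod (g * g')%g h.
Proof.
rewrite /commutes_mod -mulgA => gh g'h.
apply: eqm_trans (eqmMl g g'h) _; rewrite !mulgA.
exact: eqmMr.
Qed.

Lemma commutes_modV g h : commutes_mod g h -> commutes_mod g^-1%g h.
Proof.
move=> /eqm_sym/(eqmMl g^-1%g)/(eqmMr g^-1%g).
by rewrite /commutes_mod mulKg !mulgA mulgK.
Qed.

Lemma commutes_mod_expgz g h n : commutes_mod g h -> commutes_mod (expgz g n) h.
Proof.
move=> gh; have X k : commutes_mod (g ^+ k)%g h.
  elim: k => [|k IH]; last by rewrite expgS; exact: commutes_modM.
  by rewrite expg0 /commutes_mod mul1g mulg1; exact: eqm_refl.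
by case: n => k; [exact: X | apply/commutes_modV/X].
Qed.

Lemma commutes_mod_sym g h : commutes_mod g h -> commutes_mod h g.
Proof. exact: eqm_sym. Qed.

Lemma yi_swap i j : (yi i * yi j = yi j * yi i * val (comm_elt (i, j)))%g.
Proof.
have /centralP cz := valP (comm_elt (i, j)).
by rewrite -cz val_comm_elt; move: (yi i) (yi j) => a b; rewrite mulgA !mulgVK.
Qed.

Lemma commutes_mod_y i j n : commutes_mod (yi i) (expgz (yi j) n).
Proof.
apply/commutes_mod_sym/commutes_mod_expgz; exists (comm_elt (j, i)).
  exact/defect_span_comm/comm_span_elt.
exact: yi_swap.
Qed.

Definition prod_exp (r : seq I) (n : I -> int) : G :=
  (\prod_(i <- r) expgz (yi i) (n i))%g.

(** [yi j] passes the earlier factors, with which it commutes modulo the span, until it meets its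
    own power; by [uniq r] no other power changes. *)
Lemma mul_y_prod_exp j r n : uniq r -> j \in r ->
  eqm (yi j * prod_exp r n)%g (prod_exp r (fun i => n i + (i == j)%:R)).
Proof.
rewrite /prod_exp; elim: r => //= a r IH /andP[ar ur]; rewrite inE !big_cons.
have [-> _ | ja /= jr] := eqVneq j a.
  rewrite mulgA expgzS.
  rewrite [X in eqm (_ * X)%g](eq_big_seq (fun i => expgz (yi i) (n i + (i == a)%:R))).
    exact: eqm_refl.
  move=> i ir /=; congr expgz; case: eqVneq => [ia|]; last by rewrite addr0.
  by move: ar; rewrite -ia ir.
rewrite addr0 mulgA.
apply: eqm_trans (eqmMr _ (commutes_mod_y j a (n a))) _.
by rewrite -mulgA; apply/eqmMl/IH.
Qed.

(** * Existence of normal forms *)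

Definition normal_form (g : G) : Prop := exists (n : I -> int) (b : bool),
  eqm g (prod_exp (enum I) n * x 0 ^+ b)%g.

Lemma normal_form_eqm g h : eqm g h -> normal_form h -> normal_form g.
Proof. by move=> gh [n [b hb]]; exists n, b; exact: eqm_trans hb. Qed.

Lemma normal_form_y j g : normal_form g -> normal_form (yi j * g)%g.
Proof.
move=> [n [b gb]]; exists (fun i => n i + (i == j)%:R), b.
apply: eqm_trans (eqmMl _ gb) _; rewrite mulgA; apply/eqmMr/mul_y_prod_exp.
  exact: enum_uniq.
by rewrite mem_enum.
Qed.

Lemma normal_form_yV j g : normal_form g -> normal_form ((yi j)^-1 * g)%g.
Proof.
move=> [n [b gb]]; exists (fun i => n i - (i == j)%:R), b.
apply: eqm_trans (eqmMl _ gb) _; rewrite mulgA; apply/eqmMr.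
rewrite -[X in eqm _ X](mulKg (yi j)); apply/eqmMl/eqm_sym.
have -> : prod_exp (enum I) n =
    prod_exp (enum I) (fun i => n i - (i == j)%:R + (i == j)%:R).
  by apply: eq_bigr => i _; rewrite subrK.
apply: mul_y_prod_exp; first exact: enum_uniq.
by rewrite mem_enum.
Qed.

Lemma prod_exp_conj r n : (prod_exp r n ^ x 0)%g = prod_exp r (fun i => - n i).
Proof.
rewrite /prod_exp conjg_prod; apply: eq_bigr => i _.
by rewrite expgz_conj y_conj // expgzV.
Qed.

(** Conjugation by [x 0] inverts each [yi i], so moving [x 0] through the product negates the
    exponents and toggles the final factor. *)
Lemma normal_form_x0 g : normal_form g -> normal_form (x 0 * g)%g.
Proof.
move=> [n [b gb]]; exists (fun i => - n i), (~~ b).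
apply: eqm_trans (eqmMl _ gb) _.
rewrite mulgA [(x 0 * prod_exp _ _)%g]conjgCV x0V prod_exp_conj -mulgA; apply/eqmMl.
by case: b {gb}; rewrite ?expg1 ?xx // expg0 ?mulg1; exact: eqm_refl.
Qed.

Lemma normal_form_prod_y r g : normal_form g -> normal_form (prod_y r * g)%g.
Proof.
rewrite /prod_y; elim: r g => [|i r IH] g ng; first by rewrite big_nil mul1g.
by rewrite big_cons -mulgA; apply/normal_form_y/IH.
Qed.

(** Shifting [v] by $\pm 2\sigma_i$ conjugates [x v] by a power of [yi i], so [lattice_ind] reduces
    the claim to $\tau_P$, where [x] equals [defect P] times [prod_y (enum P)] times [x 0]. *)
Lemma normal_form_x s g : S s -> normal_form g -> normal_form (x s * g)%g.
Proof.
move=> Ss; move: g; have [P PT [c ->]] := Sdec Ss.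
pose A v := S v /\ forall g, normal_form g -> normal_form (x v * g)%g.
suff [] : A (tau sigma P + (\sum_i sigma i *~ c i) *+ 2) by [].
apply: lattice_ind => [i v [Sv Av]|].
  have Si := Ssigma i.
  have [Sp Sm e] := translates_y Si Sv; have [_ _ e'] := translates_y Si Sm.
  split; split=> //; first by rewrite addrC.
  - move=> g ng; have -> : x (v + sigma i *+ 2) = (yi i * x v * (yi i)^-1)%g.
      by rewrite e mulgK addrC.
    by rewrite -mulgA -mulgA; apply/normal_form_y/Av/normal_form_yV.
  - move=> g ng; have -> : x (v - sigma i *+ 2) = ((yi i)^-1 * x v * yi i)%g.
      by rewrite -mulgA -[in x v](subrK (sigma i *+ 2) v) [v - _ + _]addrC -e' mulKg.
    by rewrite -mulgA -mulgA; apply/normal_form_yV/Av/normal_form_y.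
split=> [|g ng]; first exact: ST.
have -> : x (tau sigma P) = (val (defect P) * prod_y (enum P) * x 0)%g.
  by rewrite val_defect // mulgVK y_x0.
apply: (@normal_form_eqm _ (prod_y (enum P) * (x 0 * g))%g); last first.
  exact/normal_form_prod_y/normal_form_x0.
exists (defect P); first exact: defect_span_elt.
by have /centralP cz := valP (defect P); rewrite -cz !mulgA.
Qed.

Lemma all_normal_form g : normal_form g.
Proof.
apply: xind g => [|s g Ss ng]; last exact: normal_form_x.
exists (fun=> 0), false; rewrite expg0 mulg1 /prod_exp big1_seq //.
exact: eqm_refl.
Qed.

(** * Action of the factors of a normal form *)

Lemma acts_y s : S s -> acts 1 (- s) (fun=> 0) (y s).
Proof.
move=> Ss; have m1sq : (- 1) ^+ 2 = 1 :> R by rewrite sqrrN expr1n.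
apply: eq_acts (actsM rhoM m1sq (actsx Ss) (actsx S0)) _ _ _.
- by rewrite mulrNN mulr1.
- by rewrite oppr0 scaler0 addr0.
- by move=> f; rewrite /wedge oppr0 ev0 scaler0 scale0r subr0 scaler0 !addr0.
Qed.

Lemma acts_comm_elt i j :
  acts 1 0 (fun f => wedge (sigma i) (sigma j) f *+ 2) (val (comm_elt (i, j))).
Proof.
have ai := acts_y (Ssigma i); have aj := acts_y (Ssigma j).
rewrite val_comm_elt.
apply: eq_acts (actsM1 rhoM (actsM1 rhoM (actsM1 rhoM ai aj)
  (actsV rho1 rhoM ai)) (actsV rho1 rhoM aj)) _ _ _ => //.
  by rewrite !opprK addrAC subrK addNr.
move=> f; rewrite /wedge !opprK !evD !evN.
by apply/rowP => k; rewrite !mxE; ring.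
Qed.

Lemma sum_lam r a : uniq r -> \sum_(i <- r) ev (lam a) (sigma i) = (a \in r)%:R.
Proof.
elim: r => [_|i r IH /= /andP[ir ur]]; first by rewrite big_nil.
rewrite big_cons lamE IH // inE; case: eqVneq => [ai|_]; last by rewrite add0r.
by rewrite ai (negbTE ir) addr0.
Qed.

(** Each new factor contributes the wedge of the translation parts, so [om] is the sum of
    $\sigma_i\wedge\sigma_j$ over [i] before [j] in [r]. Sortedness fixes the signs; only the
    coordinates are recorded. *)
Lemma acts_prod_y r : sorted ltn (map val r) ->
  exists2 om, acts 1 (- \sum_(i <- r) sigma i) om (prod_y r) &
    forall a b : I, (a < b)%N ->
      ev (lam b) (om (lam a)) = ((a \in r) && (b \in r))%:R.
Proof.
rewrite /prod_y; elim: r => [_|i r IH].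
  exists (fun=> 0); last by move=> a b _; rewrite ev0.
  by rewrite !big_nil oppr0; exact: acts1.
rewrite /= path_sortedE; last exact: ltn_trans.
move=> /andP[/allP ir0 sr].
have ir k : k \in r -> (i < k)%N by move=> kr; exact: (ir0 _ (map_f val kr)).
have [om aom omE] := IH sr.
exists (fun f => 0 + om f + wedge (- sigma i) (- \sum_(i <- r) sigma i) f).
  rewrite !big_cons.
  apply: eq_acts (actsM1 rhoM (acts_y (Ssigma i)) aom) _ _ _ => //.
  by rewrite opprD.
move=> a b ab; rewrite add0r evD omE // /wedge.
rewrite !(evD, evN, evZ, ev_sum).
have ur : uniq r.
  by apply: (@map_uniq _ _ val); apply: (sorted_uniq ltn_trans ltnn); exact: sr.
rewrite !sum_lam // !lamE !inE.
have [ai | ai] := eqVneq a i; have [bi | bi] := eqVneq b i.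
- by move: ab; rewrite ai bi ltnn.
- have /negbTE -> : a \notin r.
    by apply/negP => /ir; rewrite ai ltnn.
  by rewrite /=; ring.
- have /negbTE -> : a \notin r.
    by apply/negP => /ir; rewrite -bi => /(ltn_trans ab); rewrite ltnn.
  by rewrite /=; ring.
- by rewrite /=; ring.
Qed.

Lemma sorted_enum_set (P : {set I}) : sorted ltn (map val (enum P)).
Proof.
rewrite /enum_mem -enumT; rewrite sorted_map; apply: sorted_filter.
  by move=> ? ? ?; exact: ltn_trans.
by rewrite -sorted_map val_enum_ord; exact: iota_ltn_sorted.
Qed.

(** The two factors have opposite translation parts, whose wedge is 0, so only the inverted product
    contributes. *)
Lemma acts_defect P : P \in T -> exists2 om, acts 1 0 om (val (defect P)) &
  forall a b : I, (a < b)%N ->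
    ev (lam b) (om (lam a)) = - ((a \in P) && (b \in P))%:R.
Proof.
move=> PT; have [om aom omE] := acts_prod_y (sorted_enum_set P).
exists (fun f => - om f); last by move=> a b ab; rewrite evN omE // !mem_enum.
rewrite val_defect //.
apply: eq_acts (actsM1 rhoM (acts_y (ST PT)) (actsV rho1 rhoM aom)) _ _ _ => //.
  by rewrite opprK big_enum addNr.
by move=> f; rewrite opprK big_enum /wedge evN scalerN scaleNr subrr add0r addr0.
Qed.

Lemma acts_expgz i n : exists om, acts 1 (- (sigma i *~ n)) om (expgz (yi i) n).
Proof.
have X k : exists om, acts 1 (- (sigma i *+ k)) om (yi i ^+ k)%g.
  elim: k => [|k [om IH]].
    by exists (fun=> 0); rewrite expg0 mulr0n oppr0; exact: acts1.
  eexists; rewrite expgS mulrS opprD.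
  by apply: actsM1 IH => //; exact: acts_y.
case: n => k; first exact: X.
have [om aom] := X k.+1; exists (fun f => - om f); rewrite NegzE mulrNz.
exact: actsV aom.
Qed.

Lemma acts_prod_exp r n :
  exists om, acts 1 (- \sum_(i <- r) sigma i *~ n i) om (prod_exp r n).
Proof.
rewrite /prod_exp; elim: r => [|i r [om IH]].
  by exists (fun=> 0); rewrite !big_nil oppr0; exact: acts1.
have [om' aom'] := acts_expgz i (n i).
by eexists; rewrite !big_cons opprD; apply: actsM1 IH.
Qed.

(** * Relations between defects and commutators *)

Lemma prod_y_swap i r : exists2 z, comm_span z &
  (yi i * prod_y r = prod_y r * yi i * val z)%g.
Proof.
rewrite /prod_y; elim: r => [|j r [z Cz IH]].
  by exists 0; [exact: comm_span0 | rewrite big_nil !mulg1 mul1g].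
exists (comm_elt (i, j) + z); first by apply: comm_spanD => //; exact: comm_span_elt.
have /centralP cz := valP (comm_elt (i, j)).
rewrite big_cons; move: (yi_swap i j) IH.
move: (yi i) (yi j) (\prod_(i <- r) yi i)%g => u v F sw IH.
rewrite mulgA sw -(mulgA _ _ F) (cz F) mulgA -(mulgA v u F) IH.
by rewrite addrC val_centerD !mulgA.
Qed.

(** Conjugation by [x 0] inverts the factors without reversing their order, so the product cancels
    only up to commutators. *)
Lemma prod_y_conj r : exists2 z, comm_span z &
  (prod_y r * prod_y r ^ x 0 = val z)%g.
Proof.
elim: r => [|i r [z Cz IH]].
  by exists 0; [exact: comm_span0 | rewrite /prod_y big_nil conj1g mulg1].
have [z' Cz' sw] := prod_y_swap i r.
exists (z + z'); first exact: comm_spanD.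
have -> : prod_y (i :: r) = (yi i * prod_y r)%g by rewrite /prod_y big_cons.
have /centralP cz := valP z'.
rewrite conjMg y_conj // sw.
have -> : (prod_y r * yi i * val z' = val z' * prod_y r * yi i)%g.
  by rewrite -cz mulgA.
move: (yi i) => u.
by rewrite mulgA mulgK -mulgA IH -val_centerD addrC.
Qed.

(* [defect P] is central, hence fixed by conjugation by [x 0], which inverts
   every [y s]. *)
Lemma defect_double P : P \in T -> comm_span (defect P *+ 2).
Proof.
move=> PT; have [z Cz e] := prod_y_conj (enum P).
suff -> : defect P *+ 2 = - z by rewrite -mulrN1z; exact: comm_spanMz.
apply/eqP; rewrite -addr_eq0; apply/eqP/val_inj.
rewrite mulr2n !val_centerD -e val_center0.
have /centralP cz := valP (defect P).
have yE : y (tau sigma P) = (val (defect P) * prod_y (enum P))%g.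
  by rewrite val_defect // mulgVK.
have := y_conj (ST PT); rewrite yE conjMg.
have -> : (val (defect P) ^ x 0 = val (defect P))%g by rewrite conjgE cz mulKg.
move/(congr1 (fun g => (val (defect P) * prod_y (enum P) * g)%g)).
rewrite mulgV => <-.
by rewrite -!mulgA; congr (_ * _)%g; rewrite !mulgA cz.
Qed.

Lemma defect_small P : P \in T -> (#|P| < 2)%N -> defect P = 0.
Proof.
move=> PT; case cP: #|P| => [|[|//]] _; apply/val_inj; rewrite val_defect //.
  rewrite (cards0_eq cP) /tau /prod_y enum_set0 big_set0 big_nil y0 mulgV //.
have /cards1P[i ->] : #|P| == 1%N by rewrite cP.
by rewrite /tau big_set1 /prod_y enum_set1 big_seq1 mulgV.
Qed.

(** * Triviality of the kernel *)

Lemma ev_wedge (a b i j : I) : (a < b)%N -> (i < j)%N ->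
  ev (lam b) (wedge (sigma i) (sigma j) (lam a)) = ((i, j) == (a, b))%:R.
Proof.
move=> ab ij; rewrite /wedge !(evD, evN, evZ) !lamE xpair_eqE.
rewrite [i == a]eq_sym [j == b]eq_sym -!natrM !mulnb.
case: (_ && _); case: eqVneq => [aj|_]; case: eqVneq => [bi|_] /=; rewrite ?subr0 //.
all: by move: ab; rewrite aj bi => /(ltn_trans ij); rewrite ltnn.
Qed.

(** The coefficient of $\sigma_a\wedge\sigma_b$ in the action is $2N(a,b)$. *)
Lemma comm_span_faithful z : comm_span z -> (forall u, rho (val z) u = u) -> z = 0.
Proof.
move=> [N ->] zid; rewrite big1 // => -[a b] /= ab.
set om := fun f => \sum_(p : I * I | (p.1 < p.2)%N)
  (wedge (sigma p.1) (sigma p.2) f *+ 2) *~ N p.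
have aom : acts 1 0 om (val (\sum_(p : I * I | (p.1 < p.2)%N) comm_elt p *~ N p)).
  apply: acts_sum => //; move=> [i j] _; apply: acts_mulz => //.
  exact: acts_comm_elt.
have [_ _ /(_ (lam a))] := acts_id aom zid.
move/(congr1 (ev (lam b))); rewrite ev0 ev_sum.
rewrite (bigD1 (a, b)) //= big1 ?addr0 => [|[i j] /andP[ij nij]]; last first.
  by rewrite evMz mulr2n evD ev_wedge // (negbTE nij) addr0 mul0rz.
rewrite evMz mulr2n evD ev_wedge // eqxx => /eqP.
by rewrite mulrz_eq0 -[1 + 1]/(2%:R) pnatr_eq0 orbF => /eqP ->.
Qed.

Hypothesis indep : forall D : {set {set I}}, D \subset T ->
  (forall i j : I, (i < j)%N -> ~~ odd #|[set P in D | (i \in P) && (j \in P)]|) ->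
  forall P, P \in D -> (#|P| < 2)%N.

Lemma kernel_trivial g : (forall u, rho g u = u) -> g = 1%g.
Proof.
move=> gid; have [n [b [z [z1 [E [[N z1E] zE]]] gE]]] := all_normal_form g.
have ax0 : acts ((- 1) ^+ b) 0 (fun=> 0) (x 0 ^+ b)%g.
  case: (b) => /=; last exact: acts1.
  by rewrite expr1 expg1 -[X in acts _ X]oppr0; exact: actsx.
have [om1 aom1] := acts_prod_exp (enum I) n.
(* [acts_defect] gives mere existence; choice collects the maps into one family to be summed over
   [T]. *)
have [omP aomP] : exists omP, forall P, P \in T ->
   acts 1 0 (omP P) (val (defect P)) /\ forall a b : I, (a < b)%N ->
    ev (lam b) (omP P (lam a)) = - ((a \in P) && (b \in P))%:R.
  have X P : exists om, P \in T -> acts 1 0 om (val (defect P)) /\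
     forall a b : I, (a < b)%N ->
    ev (lam b) (om (lam a)) = - ((a \in P) && (b \in P))%:R.
    have [PT|PT] := boolP (P \in T); last by exists (fun=> 0).
    by have [om ? ?] := acts_defect PT; exists om.
  by have [f fP] := choice X; exists f.
pose om2 f :=
  \sum_(p : I * I | (p.1 < p.2)%N) (wedge (sigma p.1) (sigma p.2) f *+ 2) *~ N p +
  \sum_(P in T) omP P f *~ E P.
have aom2 : acts 1 0 om2 (val z).
  rewrite zE z1E; apply: acts_addl => //; apply: acts_sum => //.
    by move=> [i j] _; apply: acts_mulz => //; exact: acts_comm_elt.
  by move=> P PT; apply: acts_mulz => //; case: (aomP P PT).
have e2 : (1 * (- 1) ^+ b) ^+ 2 = 1 :> R by rewrite mul1r sqrr_sign.
have agz := actsM rhoM e2 (actsM rhoM (expr1n R 2) aom1 ax0) aom2.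
rewrite -gE in agz.
have [eb ep _] := acts_id agz gid.
(* The sign of the action determines [b], and its translation part, read by [lam], determines
   [n]. *)
have b0 : b = false.
  apply/negP => b1; move: eb; rewrite b1 mul1r mulr1 expr1 => /eqP.
  by rewrite eqNr oner_eq0.
have n0 i : n i = 0.
  move: ep; rewrite !scaler0 !addr0 => /eqP; rewrite oppr_eq0 => /eqP ep.
  have := congr1 (ev (lam i)) ep; rewrite ev0 ev_sum.
  rewrite (eq_bigr (fun j => if j == i then (n j)%:~R else 0)); last first.
    by move=> j _; rewrite evMz lamE eq_sym; case: eqP => // _; rewrite mul0rz.
  rewrite -big_mkcond big_enum_cond /= (big_pred1 i) // => /eqP.
  by rewrite intr_eq0 => /eqP.
have gz : g = val z.
  rewrite gE b0 expg0 mulg1 (_ : prod_exp _ _ = 1%g) ?mul1g //.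
  by rewrite /prod_exp big1 // => i _; rewrite n0.
have om20 f : om2 f = 0.
  by rewrite gz in gid; have [_ _] := acts_id aom2 gid; apply.
(* Coefficients of $\sigma_a\wedge\sigma_{b'}$ in [om2 = 0], compared in [R] and pulled back to the
   integers. *)
have coef (a b' : I) : (a < b')%N ->
    N (a, b') *+ 2 = \sum_(P in T | (a \in P) && (b' \in P)) E P.
  move=> ab; apply: (@intr_inj R).
  have := congr1 (ev (lam b')) (om20 (lam a)); rewrite /om2 ev0 evD !ev_sum.
  rewrite (bigD1 (a, b')) //= big1 ?addr0 => [|[i j] /andP[ij nij]]; last first.
    by rewrite evMz mulr2n evD ev_wedge // (negbTE nij) addr0 mul0rz.
  rewrite evMz mulr2n evD ev_wedge // eqxx => /eqP.
  rewrite addr_eq0 => /eqP; rewrite -[(1 + 1)%R]/(2%:R) => e.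
  rewrite rmorphMn /= -mulr_natl mulrzr e.
  rewrite -sumrN rmorph_sum /= big_mkcondr /=; apply: eq_bigr => P PT.
  have [_ h] := aomP P PT; rewrite evMz h //.
  by case: ifP => _; rewrite ?oppr0 ?mul0rz ?oppr0 // mulNrz opprK.
(* The left side of [coef] is even, so the sets with odd exponent cover every pair evenly and
   [indep] applies. *)
have odd_small P : P \in T -> odd `|E P|%N -> (#|P| < 2)%N.
  move=> PT oP; apply: (@indep [set P in T | odd `|E P|%N]); last by rewrite inE PT.
    by apply/fintype.subsetP => Q; rewrite inE => /andP[].
  move=> a b' ab; have := congr1 (fun k : int => odd `|k|%N) (coef a b' ab).
  rewrite (big_morph _ odd_abszD (erefl _)) -mulr_natr abszM oddM andbF => e.
  rewrite -sum1_card (big_morph _ oddD (erefl _)).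
  suff -> : \big[addb/false]_(Q in [set Q in [set P in T | odd `|E P|%N] |
      (a \in Q) && (b' \in Q)]) odd 1 =
     \big[addb/false]_(P in T | (a \in P) && (b' \in P)) odd `|E P|%N by rewrite -e.
  rewrite big_mkcond [RHS]big_mkcond; apply: eq_bigr => Q _.
  by rewrite !inE; case: (Q \in T) => //=; case: odd => //=; case: ifP.
(* Defects with odd exponent vanish by [defect_small]; an even exponent leaves a multiple of a
   doubled defect. *)
have Cz : comm_span z.
  rewrite zE; apply: comm_spanD; first by exists N.
  elim/big_ind: _ => [||P PT]; [exact: comm_span0 | exact: comm_spanD|].
  have [oP|] := boolP (odd `|E P|%N).
    by rewrite defect_small ?mul0rz ?odd_small //; exact: comm_span0.
  rewrite -dvdn2 -[2%N]/(`|2%Z|%N) -dvdzE => /dvdzP[k ->].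
  by rewrite mulrC mulrzA; apply/comm_spanMz/defect_double.
rewrite gz in gid *.
by rewrite (comm_span_faithful Cz gid).
Qed.

End Kernel.

Local Open Scope classical_set_scope.
Local Open Scope ring_scope.

(** * The support of a semilattice *)

Section SemilatticeSupport.
Variables (R : realType) (nu : nat).
Local Notation V0 := 'rV[R]_nu.
Local Notation I := 'I_nu.
Variables (S : set V0) (sigma : I -> V0).
Hypotheses (slS : semilattice S) (Ssigma : forall i, S (sigma i)).
Hypothesis basisS : int_basis (int_span S) sigma.

Lemma int_span_self v : S v -> int_span S v.
Proof.
by move=> Sv; exists 1%N, (fun=> v), (fun=> 1); split=> //; rewrite big_ord1 mulr1z.
Qed.

Lemma int_spanE v : int_span S v <-> exists c : I -> int, v = \sum_i sigma i *~ c i.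
Proof. by have [-> _] := basisS. Qed.

Lemma semilattice_shift v (c : I -> int) : S v -> S (v + (\sum_i sigma i *~ c i) *+ 2).
Proof.
move: v; apply: lattice_ind => i v Sv.
by have [_ SD _ _] := slS; exact: SD.
Qed.

(** Division by 2 in each coordinate puts every lattice vector in the class of some [tau] modulo
    $2\Lambda$. *)
Lemma int_comb_parity (c : I -> int) : \sum_i sigma i *~ c i =
  tau sigma [set i | odd `|c i|%N] + (\sum_i sigma i *~ (c i %/ 2)%Z) *+ 2.
Proof.
rewrite /tau [in RHS]big_mkcond -sumrMnl -big_split; apply: eq_bigr => i _ /=.
rewrite finset.inE {1}(divz_eq (c i) 2) mulrzDr mulrzA -pmulrn addrC; congr (_ + _).
have -> : (c i %% 2)%Z = odd `|c i|%N :> int by lia.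
by case: odd.
Qed.

(** By independence $[i\in J]-[i\in J']=2c_i$, an even number in $\{-1,0,1\}$. *)
Lemma tau_inj J J' (c : I -> int) :
  tau sigma J = tau sigma J' + (\sum_i sigma i *~ c i) *+ 2 -> J = J'.
Proof.
have [_ ind0] := basisS; move=> /eqP; rewrite -subr_eq0 opprD addrA => /eqP e.
apply/setP => i; have := ind0 (fun i => (i \in J)%:Z - (i \in J')%:Z - c i * 2) _ i.
move=> /(_ _)/wrap[]; last by case: (i \in J); case: (i \in J') => //=; lia.
rewrite -[RHS]e /tau [\sum_(j in J) _]big_mkcond [\sum_(j in J') _]big_mkcond.
rewrite -sumrMnl -!sumrB.
apply: eq_bigr => k _; rewrite !mulrzBr mulrzA -pmulrn.
by case: (k \in J); case: (k \in J').
Qed.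

(** The witness that makes the [xget] in [supp] return a set satisfying [is_supp]. *)
Definition tau_set : {set {set I}} := [set J | `[< S (tau sigma J) >]]%SET.

Lemma tau_set_is_supp : is_supp S sigma tau_set.
Proof.
split.
  by rewrite finset.inE; apply/asboolP; rewrite /tau big_set0; case: slS.
apply/seteqP; split=> [s Ss|s [J /= JT [l /int_spanE[c ->] <-]]]; last first.
  by apply: semilattice_shift; move: JT; rewrite finset.inE => /asboolP.
have [c sE] := iffLR (int_spanE s) (int_span_self Ss); rewrite int_comb_parity in sE.
exists [set i | odd `|c i|%N]%SET => /=.
  rewrite finset.inE; apply/asboolP.
  set d := fun i => - (c i %/ 2)%Z.
  rewrite (_ : tau _ _ = s + (\sum_i sigma i *~ d i) *+ 2).
    exact: semilattice_shift.
  rewrite sE -addrA -mulrnDl -big_split /= big1 ?mul0rn ?addr0 // => i _.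
  by rewrite -mulrzDr /d subrr.
exists (\sum_i sigma i *~ (c i %/ 2)%Z); last by rewrite sE.
by apply: (iffRL (int_spanE _)); eexists.
Qed.

Lemma supp_is_supp : is_supp S sigma (supp S sigma).
Proof.
apply: (@xgetPex _ finset.set0 [set T | is_supp S sigma T]).
by exists tau_set; exact: tau_set_is_supp.
Qed.

Lemma supp0 : finset.set0 \in supp S sigma.
Proof. by have [] := supp_is_supp. Qed.

Lemma supp_tau J : J \in supp S sigma -> S (tau sigma J).
Proof.
move=> JT; have [_ SE] := supp_is_supp; rewrite SE; exists J => //=.
exists 0; last by rewrite mul0rn addr0.
by apply: (iffRL (int_spanE _)); exists (fun=> 0); rewrite big1.
Qed.

Lemma supp_dec s : S s -> exists2 J, J \in supp S sigma &
  exists c : I -> int, s = tau sigma J + (\sum_i sigma i *~ c i) *+ 2.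
Proof.
have [_ SE] := supp_is_supp; rewrite {1}SE => -[J /= JT [l /int_spanE[c ->] <-]].
by exists J => //; exists c.
Qed.

Lemma supp1 i : [set i]%SET \in supp S sigma.
Proof.
have [J JT [c e]] := supp_dec (Ssigma i).
by rewrite (@tau_inj [set i]%SET J c) // /tau big_set1.
Qed.

(** [S] spans and lies in the integer span of [sigma], so these [nu] vectors span a space of
    dimension [nu] and are free. *)
Lemma dual_basis : exists lam : I -> 'Hom(V0, R^o),
  forall i j, ev (lam i) (sigma j) = (i == j)%:R.
Proof.
pose X := [tuple sigma i | i < nu].
have Xi (i : I) : X`_i = sigma i by rewrite (nth_map i) ?size_enum_ord // nth_ord_enum.
have Xspan : (fullv <= <<X>>)%VS.
  apply/subvP => v _; have [_ _ span _] := slS.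
  have : real_span S v by rewrite span.
  move=> [n [s [c [Ss ->]]]]; apply: rpred_sum => k _; apply: rpredZ.
  have [d ->] := iffLR (int_spanE (s k)) (int_span_self (Ss k)).
  apply: rpred_sum => i _; apply: rpredMz.
  by apply: memv_span; apply/mapP; exists i => //; rewrite mem_enum.
have Xfree : free X.
  have : basis_of fullv X by rewrite basisEdim Xspan size_tuple dimvf /dim /= mul1n.
  exact: basis_free.
exists (fun i => linfun (coord X i : V0 -> R^o)) => i j.
by rewrite /ev lfunE /= -Xi coord_free // eq_sym.
Qed.

End SemilatticeSupport.

(** * Reflections as linear isometries *)

Section Reflections.
Variables (R : realType) (nu : nat).
Local Notation V0 := 'rV[R]_nu.
Local Notation V := (Vtilde R nu).
Implicit Types (u v a : V) (s : V0).

Lemma bformC u v : bform u v = bform v u.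
Proof. by rewrite /bform; ring. Qed.

Lemma bformDl u v a : bform (u + v) a = bform u a + bform v a.
Proof.
rewrite /bform -[a.2 (u + v).1.2]/(ev a.2 (u.1.2 + v.1.2)) evD.
rewrite -[(u + v).2]/(u.2 + v.2) lfunE /= /ev.
(* Values in [R^o] are renamed as elements of [R], for [ring]. *)
set x1 : R := a.2 u.1.2; set x2 : R := a.2 v.1.2.
set x3 : R := u.2 a.1.2; set x4 : R := v.2 a.1.2.
change (2 * (u.1.1 + v.1.1) * a.1.1 + (x1 + x2 + (x3 + x4)) =
  2 * u.1.1 * a.1.1 + (x1 + x3) + (2 * v.1.1 * a.1.1 + (x2 + x4)) :> R); ring.
Qed.

Lemma bformZl k u a : bform (k *: u) a = k * bform u a.
Proof.
rewrite /bform -[a.2 (k *: u).1.2]/(ev a.2 (k *: u.1.2)) evZ.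
rewrite -[(k *: u).2]/(k *: u.2) lfunE /= /ev.
set x1 : R := a.2 u.1.2; set x3 : R := u.2 a.1.2.
change (2 * (k * u.1.1) * a.1.1 + (k * x1 + k * x3) =
  k * (2 * u.1.1 * a.1.1 + (x1 + x3)) :> R); ring.
Qed.

Lemma reflection_is_linear a : linear (reflection a).
Proof.
move=> k u v; rewrite /reflection bformDl bformZl scalerDl opprD scalerBr scalerA.
by rewrite addrACA.
Qed.

HB.instance Definition _ a :=
  GRing.isLinear.Build R V V _ (reflection a) (reflection_is_linear a).

Lemma reflectionBZ a u k v :
  reflection a (u - k *: v) = reflection a u - k *: reflection a v.
Proof. by rewrite addrC -scaleNr reflection_is_linear scaleNr addrC. Qed.

Lemma reflectionK a : bform a a = 2 -> involutive (reflection a).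
Proof.
move=> aa u; rewrite {1}/reflection.
have -> : bform (reflection a u) a = - bform u a.
  by rewrite /reflection -scaleNr bformDl bformZl aa; ring.
by rewrite scaleNr opprK subrK.
Qed.

Lemma reflection_isometry a : bform a a = 2 ->
  forall u v, bform (reflection a u) (reflection a v) = bform u v.
Proof.
move=> aa u v; rewrite /reflection -!scaleNr bformDl bformZl.
rewrite ![bform _ (v + _)]bformC !bformDl !bformZl aa.
rewrite [bform v u]bformC [bform a u]bformC; ring.
Qed.

(** As $w_a$ is an isometric involution, $(u,w_a b)=(w_a u,b)$. *)
Lemma reflection_conj a b u : bform a a = 2 ->
  reflection (reflection a b) u = reflection a (reflection b (reflection a u)).
Proof.
move=> aa; have bE y : reflection b y = y - bform y b *: b by [].
rewrite (bE (reflection a u)) reflectionBZ (reflectionK aa).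
by rewrite -(reflection_isometry aa) (reflectionK aa).
Qed.

Lemma reflection_orthogonal a : bform a a = 2 ->
  linfun (reflection a) \in orthogonal_set (@bform R nu).
Proof.
move=> aa; rewrite inE; split; last first.
  by move=> u v; rewrite !lfunE /= reflection_isometry.
by exists (linfun (reflection a)) => u; rewrite !lfunE /= reflectionK.
Qed.

Lemma root_posE s : alpha1 R nu + inV0 s = ((1, s), 0).
Proof. by rewrite -[LHS]/((1 + 0, 0 + s), 0 + 0) !addr0 add0r. Qed.

Lemma root_negE s : - alpha1 R nu + inV0 s = ((- 1, s), 0).
Proof. by rewrite -[LHS]/((- 1 + 0, - 0 + s), - 0 + 0) !addr0 oppr0 add0r oppr0. Qed.

Lemma reflectionE (e : R) s (a : R) (v : V0) (f : 'Hom(V0, R^o)) :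
  reflection ((e, s), 0) ((a, v), f) =
  ((a - (2 * a * e + ev f s) * e, v - (2 * a * e + ev f s) *: s), f).
Proof.
rewrite /reflection; have -> : bform ((a, v), f) ((e, s), 0) = 2 * a * e + ev f s.
  by rewrite /bform /= lfunE /= add0r.
move: (2 * a * e + _) => c.
by rewrite -[LHS]/((a - c * e, v - c *: s), f - c *: 0) scaler0 subr0.
Qed.

Lemma bform_root (e : R) s : e ^+ 2 = 1 -> bform ((e, s), 0) ((e, s), 0) = 2.
Proof. by move=> e2; rewrite /bform /= lfunE /= !addr0 -mulrA -expr2 e2 mulr1. Qed.

End Reflections.

(** * From the presented group to the Weyl group *)

Section HatWeyl.
Variables (R : realType) (nu : nat) (S : set 'rV[R]_nu).
Local Notation V0 := 'rV[R]_nu.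
Local Notation V := (Vtilde R nu).
Local Notation X := (nonisotropic_roots S).
Local Notation G := (hat_weyl_group S).
Local Notation W := (weyl_group S).

Lemma nonisotropic_rootsP (a : V) : X a <->
  exists s, S s /\ (a = ((1, s), 0) \/ a = ((- 1, s), 0)).
Proof.
split=> [[[[s [t [_ _ ->]]]|[s [Ss aE]]] nz]|[s [Ss aE]]].
- by case: nz; rewrite /bform /= lfunE /= mulr0 !addr0.
- by exists s; rewrite -root_posE -root_negE.
split; first by right; exists s; rewrite root_posE root_negE.
by case: aE => ->; rewrite bform_root ?sqrrN ?expr1n //; apply/eqP; rewrite pnatr_eq0.
Qed.

Lemma bform_nonisotropic (a : V) : X a -> bform a a = 2.
Proof.
by move=> /nonisotropic_rootsP[s [_ [] ->]]; rewrite bform_root // ?sqrrN expr1n.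
Qed.

Definition hat_cl (w : gword X) : G := \pi_(presented (@conjugation_rel R nu S))%qT w.

Lemma hat_clM u v : hat_cl (u ++ v) = (hat_cl u * hat_cl v)%g.
Proof. exact/esym/presented_mulE. Qed.

Lemma hat_cl1 : hat_cl [::] = 1%g.
Proof. by []. Qed.

Lemma hat_cl_eq u v : gword_eq (@conjugation_rel R nu S) u v <-> hat_cl u = hat_cl v.
Proof. exact: presented_clP. Qed.

Lemma hat_cl_gen (a : X) (b : bool) : hat_cl [:: (a, b)] = hat_cl [:: hat_gen a].
Proof.
case: b => //; have sq : (hat_cl [:: hat_gen a] * hat_cl [:: hat_gen a])%g = 1%g.
  by rewrite -hat_clM; apply/hat_cl_eq/gword_eq_rel/conj_rel_square.
apply: (mulgI (hat_cl [:: hat_gen a])); rewrite sq -hat_clM.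
by apply/hat_cl_eq/(gword_eq_cancel _ a false).
Qed.

Lemma root_of_S s : S s -> ((1, s), 0) \in X.
Proof. by move=> Ss; apply/mem_set/nonisotropic_rootsP; exists s; split=> //; left. Qed.

(** The value 1 outside [S] makes the generators a total function on [V0]. *)
Definition hat_x (s : V0) : G :=
  if pselect (S s) is left Ss
  then hat_cl [:: hat_gen (exist (fun a : V => a \in X) _ (root_of_S Ss))] else 1%g.

Lemma hat_xE (a : X) s : S s -> val a = ((1, s), 0) -> hat_x s = hat_cl [:: hat_gen a].
Proof.
move=> Ss aE; rewrite /hat_x; case: pselect => // Ss'.
by congr hat_cl; congr [:: hat_gen _]; apply/val_inj; rewrite aE.
Qed.

Hypothesis S0 : S 0.
Hypothesis SD : forall s t, S s -> S t -> S (s + t *+ 2) /\ S (s - t *+ 2).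

Lemma hat_xx s : S s -> (hat_x s * hat_x s)%g = 1%g.
Proof.
move=> Ss; pose a : X := exist (fun a : V => a \in X) _ (root_of_S Ss).
rewrite (@hat_xE a) // -hat_clM.
by apply/hat_cl_eq/gword_eq_rel/conj_rel_square.
Qed.

Lemma hat_conj (a b c : X) : val c = reflection (val a) (val b) ->
  (hat_cl [:: hat_gen a] * hat_cl [:: hat_gen b] * hat_cl [:: hat_gen a])%g
  = hat_cl [:: hat_gen c].
Proof.
move=> cE; rewrite -!hat_clM.
by apply/hat_cl_eq/gword_eq_rel/conj_rel_conj.
Qed.

Lemma neg_root_of_S s : S s -> ((- 1, s), 0) \in X.
Proof. by move=> Ss; apply/mem_set/nonisotropic_rootsP; exists s; split=> //; right. Qed.

(* [w_b b = - b], so the generators of [b] and [- b] coincide. *)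
Lemma hat_x_neg (a : X) s : S s -> val a = ((- 1, s), 0) ->
  hat_x (- s) = hat_cl [:: hat_gen a].
Proof.
move=> Ss aE.
have SNs : S (- s) by have [_] := SD Ss Ss; rewrite mulr2n opprD addNKr.
pose b : X := exist (fun a : V => a \in X) _ (root_of_S SNs).
rewrite (@hat_xE b) // -(@hat_conj b b a).
  have sq := hat_xx SNs; rewrite (@hat_xE b) // in sq.
  by rewrite sq mul1g.
rewrite aE /= reflectionE ev0l addr0 !mulr1; congr (_, _, _); first by lra.
rewrite scalerN opprK -{2}[s]scale1r -scaleNr -scalerDl.
by rewrite (_ : - 1 + 2 = 1) ?scale1r //; lra.
Qed.

(** The reflection sends $\alpha_1+t$ to $-\alpha_1+(t-2s)$, whose generator is also that of
    $\alpha_1+(2s-t)$. *)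
Lemma hat_xJ s t : S s -> S t -> (hat_x s * hat_x t * hat_x s)%g = hat_x (s *+ 2 - t).
Proof.
move=> Ss St.
pose a : X := exist (fun a : V => a \in X) _ (root_of_S Ss).
pose b : X := exist (fun a : V => a \in X) _ (root_of_S St).
have Sts : S (t - s *+ 2) by case: (SD St Ss).
pose c : X := exist (fun a : V => a \in X) _ (neg_root_of_S Sts).
rewrite (@hat_xE a) // (@hat_xE b) // (@hat_conj a b c).
  by rewrite -(@hat_x_neg c (t - s *+ 2)) // opprB.
rewrite /= reflectionE ev0l addr0 !mulr1; congr (_, _, _); first by lra.
by rewrite scaler_nat.
Qed.

Lemma hat_gen_x (a : X) : exists2 s, S s & hat_cl [:: hat_gen a] = hat_x s.
Proof.
have /set_mem/nonisotropic_rootsP[s [Ss [] aE]] := valP a.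
  by exists s => //; rewrite (hat_xE Ss aE).
exists (- s); last by rewrite (hat_x_neg Ss aE).
by have [_] := SD Ss Ss; rewrite mulr2n opprD addNKr.
Qed.

Lemma hat_ind (Q : G -> Prop) : Q 1%g ->
  (forall s g, S s -> Q g -> Q (hat_x s * g)%g) -> forall g, Q g.
Proof.
move=> Q1 QM; elim/quotW => w; rewrite -/(hat_cl w).
elim: w => [|[a b] w IH]; first by rewrite hat_cl1.
rewrite -cat1s hat_clM hat_cl_gen; have [s Ss ->] := hat_gen_x a.
exact: QM.
Qed.

Definition weyl_act (g : W) (u : V) : V := (val (val g) : 'End(V)) u.

Lemma weyl_act_inj (g h : W) : weyl_act g =1 weyl_act h -> g = h.
Proof. by move=> gh; do 2 apply/val_inj; apply/lfunP. Qed.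

Lemma weyl_act1 u : weyl_act 1%g u = u.
Proof. by rewrite /weyl_act lfunE. Qed.

Lemma weyl_actM g h u : weyl_act (g * h)%g u = weyl_act g (weyl_act h u).
Proof. by rewrite /weyl_act -comp_lfunE. Qed.

Definition root_orth (a : X) : orthogonal_group (@bform R nu) :=
  exist (fun f => f \in orthogonal_set (@bform R nu)) _
    (reflection_orthogonal (bform_nonisotropic (set_mem (valP a)))).

Lemma root_orth_gen (a : X) : root_orth a \in generated_set (root_reflections S).
Proof.
have h : root_reflections S (root_orth a).
  by exists (val a) => [|u]; [exact: set_mem (valP a) | rewrite /= lfunE].
by apply/mem_set => H [_]; apply.
Qed.

Definition root_weyl (a : X) : W :=
  exist (fun f => f \in generated_set (root_reflections S)) _ (root_orth_gen a).

Lemma root_weylE a u : weyl_act (root_weyl a) u = reflection (val a) u.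
Proof. by rewrite /weyl_act /= lfunE. Qed.

Definition weyl_eval (w : gword X) : W := foldr (fun l g => root_weyl l.1 * g)%g 1%g w.

Lemma weyl_evalM u v : weyl_eval (u ++ v) = (weyl_eval u * weyl_eval v)%g.
Proof. by elim: u => [|l u IH] /=; rewrite ?mul1g // IH mulgA. Qed.

Lemma root_weyl_sq a : (root_weyl a * root_weyl a)%g = 1%g.
Proof.
apply: weyl_act_inj => u; rewrite weyl_actM !root_weylE weyl_act1 reflectionK //.
exact: bform_nonisotropic (set_mem (valP a)).
Qed.

Lemma weyl_eval_eq u v :
  gword_eq (@conjugation_rel R nu S) u v -> weyl_eval u = weyl_eval v.
Proof.
elim=> {u v} [//|u v _ ->//|u v w _ -> _ ->//|u u' v v' _ e _ e'|a b|u v].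
- by rewrite !weyl_evalM e e'.
- by rewrite /= mulg1 root_weyl_sq.
case=> [a|a b c cE]; first by rewrite /= mulg1 root_weyl_sq.
rewrite /= !mulg1; apply: weyl_act_inj => u'.
rewrite !weyl_actM !root_weylE cE.
exact/esym/reflection_conj/bform_nonisotropic/set_mem/valP.
Qed.

Definition hat_to_weyl (g : G) : W := weyl_eval (repr g).

Lemma hat_to_weyl_cl w : hat_to_weyl (hat_cl w) = weyl_eval w.
Proof. exact/weyl_eval_eq/repr_cl. Qed.

Lemma hat_to_weylM g h : hat_to_weyl (g * h)%g = (hat_to_weyl g * hat_to_weyl h)%g.
Proof. by rewrite [X in hat_to_weyl X]/(hat_cl _) hat_to_weyl_cl weyl_evalM. Qed.

Lemma hat_to_weyl1 : hat_to_weyl 1%g = 1%g.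
Proof. exact: (hat_to_weyl_cl [::]). Qed.

Definition hat_act (g : G) (u : V) : V := weyl_act (hat_to_weyl g) u.

Lemma hat_act1 u : hat_act 1%g u = u.
Proof. by rewrite /hat_act hat_to_weyl1 weyl_act1. Qed.

Lemma hat_actM g h u : hat_act (g * h)%g u = hat_act g (hat_act h u).
Proof. by rewrite /hat_act hat_to_weylM weyl_actM. Qed.

Lemma hat_act_x s u : S s -> hat_act (hat_x s) u = reflection ((1, s), 0) u.
Proof.
move=> Ss; pose a : X := exist (fun a : V => a \in X) _ (root_of_S Ss).
by rewrite (@hat_xE a) // /hat_act hat_to_weyl_cl /= mulg1 root_weylE.
Qed.

Lemma acts_hat_x s : S s -> acts hat_act (- 1) (- s) (fun=> 0) (hat_x s).
Proof.
move=> Ss a v f; rewrite hat_act_x // reflectionE evN; congr (_, _, _); first by ring.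
by apply/rowP => k; rewrite !mxE; ring.
Qed.

(** The image is a subgroup containing all root reflections. *)
Lemma hat_to_weyl_surj (w : W) : exists g, hat_to_weyl g = w.
Proof.
pose H : set (orthogonal_group (@bform R nu)) :=
  [set f | exists g, val (hat_to_weyl g) = f].
suff [g gw] : H (val w) by exists g; apply/val_inj.
have Hsub : generated_set (root_reflections S) `<=` H.
  apply: smallest_sub.
    split; first by rewrite inE; exists 1%g; rewrite hat_to_weyl1.
    move=> _ _ /set_mem[g <-] /set_mem[h <-]; apply/mem_set.
    exists (g * h^-1)%g; rewrite hat_to_weylM.
    have -> : hat_to_weyl h^-1%g = (hat_to_weyl h)^-1%g.
      by apply/esym/mulg1_eq; rewrite -hat_to_weylM mulgV hat_to_weyl1.
    by [].
  move=> f [a Xa fE]; pose b : X := exist (fun a : V => a \in X) _ (mem_set Xa).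
  exists (hat_cl [:: hat_gen b]); rewrite hat_to_weyl_cl /= mulg1.
  by apply/val_inj/lfunP => u; rewrite fE; exact: root_weylE.
exact/Hsub/set_mem/valP.
Qed.

(** A trivial kernel makes [hat_to_weyl] bijective; its inverse is the required isomorphism. *)
Lemma presentation_by_conjugation_inj :
  (forall g, (forall u, hat_act g u = u) -> g = 1%g) -> presentation_by_conjugation S.
Proof.
move=> triv.
have inj : injective hat_to_weyl.
  move=> g h gh; apply: divg1_eq; apply: triv => u.
  by rewrite hat_actM /hat_act gh -/(hat_act _ _) -hat_actM mulgV hat_act1.
pose f w := sval (cid (hat_to_weyl_surj w)).
have fK : cancel f hat_to_weyl by move=> w; rewrite /f; case: cid.
have Kf : cancel hat_to_weyl f by move=> g; apply: inj; rewrite fK.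
have fM : {morph f : x y / (x * y)%g}.
  by move=> x y; apply: inj; rewrite hat_to_weylM !fK.
pose F : {multiplicative W -> G} := HB.pack f (isMultiplicative.Build W G f fM).
by exists F; exists hat_to_weyl.
Qed.

End HatWeyl.

(** * The abelianization and the case of full support in rank 3 *)

Section Classes.
Variables (R : realType) (nu : nat) (S : set 'rV[R]_nu).
Local Notation V0 := 'rV[R]_nu.
Local Notation V := (Vtilde R nu).
Local Notation I := 'I_nu.
Local Notation X := (nonisotropic_roots S).
Local Notation G := (hat_weyl_group S).
Variable sigma : I -> V0.
Hypotheses (slS : semilattice S) (Ssigma : forall i, S (sigma i)).
Hypothesis basisS : int_basis (int_span S) sigma.

Let S0 : S 0. Proof. by case: slS. Qed.
Let SD s t : S s -> S t -> S (s + t *+ 2) /\ S (s - t *+ 2).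
Proof. by case: slS => _ SD _ _; exact: SD. Qed.

(* [a] is [e alpha_1 + s] with [s] in the class of [tau J] modulo 2 Lambda; the
   sign [e] is left free because both signs give the same generator. *)
Definition root_class (J : {set I}) (a : V) : bool :=
  `[< exists (e : R) (c : I -> int),
        a = ((e, tau sigma J + (\sum_i sigma i *~ c i) *+ 2), 0) >].

Lemma root_class_reflection J (a : X) (b : V) :
  root_class J b -> X b -> root_class J (reflection (val a) b).
Proof.
move=> /asboolP[e [c ->]] /nonisotropic_rootsP[s0 [_ ebE]]; apply/asboolP.
have eE : e = 1 \/ e = -1 by case: ebE => -[-> _]; [left | right].
have /set_mem/nonisotropic_rootsP[s [Ss saE]] := valP a.
have [d sE] := iffLR (int_spanE basisS s) (int_span_self Ss).
have [e' [aE e'E]] : exists e', val a = ((e', s), 0) /\ (e' = 1 \/ e' = -1).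
  by case: saE => ->; eexists; split=> //; [left | right].
rewrite aE reflectionE ev0l addr0.
(* Here $k=ee'=\pm1$, so the reflection moves the [V0] part by an element of $2\Lambda$. *)
have [k kE] : exists k : int, 2 * e * e' = k%:~R *+ 2.
  by case: eE e'E => -> [] ->; [exists 1|exists (-1)|exists (-1)|exists 1];
     rewrite ?mulr1 ?mulrN1 ?opprK ?mulr1 ?rmorphN /= ?mulr2n; ring.
exists (e - 2 * e * e' * e'), (fun i => c i - d i * k); congr (_, _, _).
rewrite kE -addrA; congr (_ + _); rewrite -scalerMnl scaler_int sE -mulrnBl.
rewrite mulrz_suml -sumrB; congr (_ *+ 2); apply: eq_bigr => i _.
by rewrite mulrzBr mulrzA.
Qed.

Lemma root_class_conj J (a b c : X) : val c = reflection (val a) (val b) ->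
  root_class J (val b) = root_class J (val c).
Proof.
move=> cE; have Xb := set_mem (valP b); have Xc := set_mem (valP c).
apply/idP/idP => h; first by rewrite cE; exact: root_class_reflection.
rewrite -(reflectionK (bform_nonisotropic (set_mem (valP a))) (val b)) -cE.
exact: root_class_reflection.
Qed.

(** One coordinate of the map from words to a power of $\mathbb Z/2$ through the abelianization. *)
Definition word_class J (w : gword X) : bool :=
  odd (count (fun l => root_class J (val l.1)) w).

Lemma word_class_eq J u v :
  gword_eq (@conjugation_rel R nu S) u v -> word_class J u = word_class J v.
Proof.
rewrite /word_class.
elim=> {u v} [//|u v _ ->//|u v w _ -> _ ->//|u u' v v' _ e _ e'|a b|u v].
- by rewrite !count_cat !oddD e e'.
- by rewrite /= addn0 addnn odd_double.
case=> [a|a b c cE]; first by rewrite /= addn0 addnn odd_double.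
rewrite /= !addn0 (root_class_conj J cE) !oddD addbCA addbb addbF.
by [].
Qed.

Definition hat_class J (g : G) : bool := word_class J (repr g).

Lemma hat_class_cl J w : hat_class J (hat_cl w) = word_class J w.
Proof. exact/word_class_eq/repr_cl. Qed.

Lemma hat_classM J g h : hat_class J (g * h)%g = hat_class J g (+) hat_class J h.
Proof.
by rewrite [X in hat_class J X]/(hat_cl _) hat_class_cl /word_class count_cat oddD.
Qed.

Lemma hat_class1 J : hat_class J 1%g = false.
Proof. exact: (hat_class_cl J [::]). Qed.

Lemma hat_class_x J K (c : I -> int) s : S s ->
  s = tau sigma K + (\sum_i sigma i *~ c i) *+ 2 -> hat_class J (hat_x S s) = (J == K).
Proof.
move=> Ss sE; pose a : X := exist (fun a : V => a \in X) _ (root_of_S Ss).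
rewrite (@hat_xE _ _ _ a s) // hat_class_cl /word_class /= addn0 oddb.
apply/asboolP/eqP => [[e [d [_ e2]]]|->]; last by exists 1, c; rewrite -sE.
apply: (tau_inj basisS (c := fun i => c i - d i)).
rewrite -[LHS](addrK ((\sum_i sigma i *~ d i) *+ 2)) -e2 sE.
rewrite -addrA -mulrnBl -sumrB; congr (_ + _ *+ 2).
by apply: eq_bigr => i _; rewrite mulrzBr.
Qed.

(** A morphism to $\mathbb Z/2$ forgets conjugation, so [h] agrees at $r$ and $2t-r$; using $t=0$
    and $t=\sigma_i$ gives the shifts by $\pm2\sigma_i$. *)
Lemma abelian_hom_shift (h : G -> bool) :
  (forall g g', h (g * g')%g = h g (+) h g') ->
  forall (c : I -> int) s, S s ->
    h (hat_x S (s + (\sum_i sigma i *~ c i) *+ 2)) = h (hat_x S s).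
Proof.
move=> hM c s Ss.
have SN t : S t -> S (- t).
  by move=> St; have [_] := SD St St; rewrite mulr2n opprD addNKr.
have refl t r : S t -> S r -> h (hat_x S (t *+ 2 - r)) = h (hat_x S r).
  by move=> St Sr; rewrite -hat_xJ // !hM addbC addbA addbb.
have opp t : S t -> h (hat_x S (- t)) = h (hat_x S t).
  by move=> St; rewrite -(refl 0 t) // mul0rn sub0r.
pose A v := S v /\ h (hat_x S v) = h (hat_x S s).
suff [] : A (s + (\sum_i sigma i *~ c i) *+ 2) by [].
apply: lattice_ind => // i v [Sv Av].
have [Sp Sm] := SD Sv (Ssigma i); split; split=> //; rewrite -Av.
  by rewrite -[v in LHS]opprK addrC refl ?opp //; exact: SN.
by rewrite -opp // opprB refl.
Qed.

End Classes.

(** * A relation between eight reflections *)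

Section CubeRelation.
Variables (R : realType) (nu : nat) (S : set 'rV[R]_nu).
Local Notation x := (hat_x S).

(** Both sides have sign 1, no translation part and skew part $-a\wedge b$; on the right, $-c\wedge
    a$ and $-a\wedge c$ cancel. *)
Lemma cube_relation a b c : S 0 -> S a -> S b -> S c -> S (a + b) -> S (a + c) ->
  S (b + c) -> S (a + b + c) ->
  hat_to_weyl (x 0 * x a * x (a + b) * x b)%g =
  hat_to_weyl (x c * x (a + c) * x (a + b + c) * x (b + c))%g.
Proof.
move=> S0 Sa Sb Sc Sab Sac Sbc Sabc.
have aE g u : weyl_act (hat_to_weyl g) u = hat_act g u by [].
have rE s (p : R) v f : S s -> hat_act (x s) ((p, v), f) =
    ((- p - ev f s : R, v - (2 * p + ev f s) *: s), f).
  by move=> Ss; rewrite hat_act_x // reflectionE !mulr1; congr (_, _, _); ring.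
apply: weyl_act_inj => -[[p v] f]; rewrite !aE !hat_actM.
rewrite !rE //.
have e1 : forall p1 p2 : R, forall v1 v2 : 'rV[R]_nu, p1 = p2 -> v1 = v2 ->
  ((p1, v1), f) = ((p2, v2), f) :> Vtilde R nu by move=> ? ? ? ? -> ->.
apply: e1; rewrite !evD ev0.
  by ring.
by apply/rowP => k; rewrite !mxE; ring.
Qed.

End CubeRelation.

Section Cube.
Variables (R : realType) (S : set 'rV[R]_3) (sigma : 'I_3 -> 'rV[R]_3).
Hypotheses (slS : semilattice S) (Ssigma : forall i, S (sigma i)).
Hypothesis basisS : int_basis (int_span S) sigma.
Hypothesis suppT : forall J, J \in supp S sigma.
Local Notation G := (hat_weyl_group S).
Local Notation W := (weyl_group S).
Local Notation t := (tau sigma).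

Let S0 : S 0. Proof. by case: slS. Qed.
Let SD s s' : S s -> S s' -> S (s + s' *+ 2) /\ S (s - s' *+ 2).
Proof. by case: slS => _ SD _ _; exact: SD. Qed.
Let Stau J : S (t J). Proof. exact: supp_tau. Qed.

(** Listed in the order of [cube_relation]: the left side, then the right side. *)
Definition cube_sets : seq {set 'I_3} :=
  let i0 := inord 0 in let i1 := inord 1 in let i2 := inord 2 in
  [:: finset.set0; [set i0]; [set i0; i1]; [set i1];
      [set i2]; [set i0; i2]; i2 |: [set i0; i1]; [set i1; i2]]%SET.

Lemma cube_sets_uniq : uniq cube_sets.
Proof.
apply: (@map_uniq _ _ (fun J : {set 'I_3} =>
  (inord 0 \in J, inord 1 \in J, inord 2 \in J))).
by rewrite /= !inE -!val_eqE /= !inordK.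
Qed.

Lemma cube_setsE (J : {set 'I_3}) : J \in cube_sets.
Proof.
have [_ e] : (size cube_sets = size (enum {set 'I_3})) * (cube_sets =i enum {set 'I_3}).
  apply: uniq_min_size; [exact: cube_sets_uniq| |].
    by move=> K _; rewrite mem_enum.
  by rewrite -cardT -cardsT -powersetT card_powerset cardsT card_ord.
by rewrite e mem_enum.
Qed.

(** Each of the eight generators occurs exactly once in [cube_relation], so moving all to one side
    gives the sum modulo 2. *)
Lemma cube_relation_tau (h : W -> bool) :
  (forall g g', h (g * g')%g = h g (+) h g') ->
  \big[addb/false]_J h (hat_to_weyl (hat_x S (t J))) = false.
Proof.
move=> hM.
have -> : \big[addb/false]_J h (hat_to_weyl (hat_x S (t J))) =
          \big[addb/false]_(J <- cube_sets) h (hat_to_weyl (hat_x S (t J))).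
  rewrite [in RHS]big_uniq ?cube_sets_uniq //; apply: eq_bigl => J.
  by rewrite cube_setsE.
rewrite /cube_sets; set i0 := inord 0; set i1 := inord 1; set i2 := inord 2.
have i01 : i0 != i1 by rewrite -val_eqE /= !inordK.
have i02 : i0 != i2 by rewrite -val_eqE /= !inordK.
have i12 : i1 != i2 by rewrite -val_eqE /= !inordK.
have t2 i j : i != j -> t [set i; j]%SET = sigma i + sigma j.
  by move=> ij; rewrite /tau big_setU1 ?inE // big_set1.
have t1 i : t [set i]%SET = sigma i by rewrite /tau big_set1.
have t0 : t finset.set0 = 0 by rewrite /tau big_set0.
have t3 : t (i2 |: [set i0; i1])%SET = sigma i0 + sigma i1 + sigma i2.
  rewrite /tau big_setU1; last by rewrite !inE ![i2 == _]eq_sym negb_or i02.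
  by rewrite /= -/(t _) t2 // addrC.
rewrite !big_cons big_nil t0 !t1 t3 !t2 //.
have S01 : S (sigma i0 + sigma i1) by rewrite -t2.
have S02 : S (sigma i0 + sigma i2) by rewrite -t2.
have S12 : S (sigma i1 + sigma i2) by rewrite -t2.
have S012 : S (sigma i0 + sigma i1 + sigma i2) by rewrite -t3.
have := congr1 h (cube_relation S0
  (Ssigma i0) (Ssigma i1) (Ssigma i2) S01 S02 S12 S012).
rewrite !hat_to_weylM !hM addbF.
by do 8! case: (h _).
Qed.

(** An isomorphism [F] would make [theta] a surjective endomorphism of the presented group, inducing
    a surjective endomorphism of $(\mathbb Z/2)^8$. By finiteness that is injective, yet the cube
    relation makes it kill the all-ones vector. *)
Lemma cube_not_presented : ~ presentation_by_conjugation S.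
Proof.
move=> [F [F' FK F'K]].
pose theta (g : G) : G := F (hat_to_weyl g).
have thetaM g h : theta (g * h)%g = (theta g * theta h)%g.
  by rewrite /theta hat_to_weylM gmulfM.
have theta1 : theta 1%g = 1%g.
  by apply: (mulgI (theta 1%g)); rewrite -thetaM !mulg1.
(* [M] is the matrix of the induced endomorphism [Phi]. *)
pose M I J := hat_class sigma I (theta (hat_x S (t J))).
pose Phi (v : {ffun {set 'I_3} -> bool}) : {ffun {set 'I_3} -> bool} :=
  [ffun I => \big[addb/false]_J (M I J && v J)].
have thetaE I g : hat_class sigma I (theta g) =
    \big[addb/false]_J (M I J && hat_class sigma J g).
  pose Q g := hat_class sigma I (theta g) =
    \big[addb/false]_J (M I J && hat_class sigma J g).
  apply: (hat_ind SD (Q := Q)) => [|s {}g Ss]; rewrite /Q.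
    rewrite theta1 (hat_class1 basisS) big1 // => J _.
    by rewrite (hat_class1 basisS) andbF.
  move=> IH; have [K KT [c sE]] := supp_dec slS Ssigma basisS Ss.
  rewrite thetaM (hat_classM basisS) IH.
  (* Coordinate [I] of [theta] is a morphism to $\mathbb Z/2$, so it takes the same value at [s] as
     at the representative [t K]. *)
  have -> : hat_class sigma I (theta (hat_x S s)) = M I K.
    pose h g1 := hat_class sigma I (theta g1).
    rewrite sE; apply: (abelian_hom_shift slS Ssigma (h := h)) => //.
    by move=> g1 g2; rewrite /h thetaM (hat_classM basisS).
  rewrite [X in X (+) _](_ : _ =
      \big[addb/false]_J (M I J && hat_class sigma J (hat_x S s))).
    rewrite -big_split; apply: eq_bigr => J _.
    by rewrite /= (hat_classM basisS) andb_addr.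
  rewrite (bigD1 K) //= (hat_class_x basisS _ Ss sE) eqxx andbT big1 ?addbF // => J JK.
  by rewrite (hat_class_x basisS _ Ss sE) (negbTE JK) andbF.
have class_surj (v : {ffun {set 'I_3} -> bool}) : exists g : G, forall J,
      hat_class (S := S) sigma J g = v J.
  pose f K : G := if v K then hat_x S (t K) else 1%g.
  pose g : G := (\prod_(K : {set 'I_3}) f K)%g.
  exists g => J; rewrite /g /f.
  have tE K : t K = t K + (\sum_i sigma i *~ (0 : int)) *+ 2.
    by rewrite big1 ?mul0rn ?addr0.
  have h1 := hat_class1 basisS J.
  have hM := hat_classM basisS J.
  rewrite (big_morph _ hM h1) (bigD1 J) //= big1 => [|K KJ].
    by case: (v J); rewrite ?h1 // (hat_class_x basisS _ (Stau J) (tE J)) eqxx.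
  by case: (v K); rewrite // (hat_class_x basisS _ (Stau K) (tE K)) eq_sym (negbTE KJ).
have Phi_surj v : exists w, Phi w = v.
  have [g gv] := class_surj v.
  have [g' g'E] := hat_to_weyl_surj (F' g).
  exists [ffun J => hat_class sigma J g']; apply/ffunP => I; rewrite ffunE -gv.
  rewrite -[g in RHS]F'K -g'E -/(theta g') thetaE.
  by apply: eq_bigr => J _; rewrite ffunE.
(* A section [r] of [Phi] is an injective self-map of a finite type, hence bijective, and [Phi] is
   its inverse. *)
have Phi_inj : injective Phi.
  pose r v := sval (cid (Phi_surj v)).
  have rK : cancel r Phi by move=> v; rewrite /r; case: cid.
  have [r' K1 K2] := injF_bij (can_inj rK).
  by apply: (can_inj (g := r)) => v; rewrite -[v]K2 rK.
have : Phi [ffun=> true] = Phi [ffun=> false].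
  apply/ffunP => I; rewrite !ffunE.
  rewrite [RHS]big1 => [|J _]; last by rewrite ffunE andbF.
  under eq_bigr do rewrite ffunE andbT.
  apply: (cube_relation_tau (h := fun w => hat_class sigma I (F w))) => g g'.
  by rewrite gmulfM (hat_classM basisS).
by move/Phi_inj/ffunP/(_ finset.set0); rewrite !ffunE.
Qed.

End Cube.

(** * Index conditions for the presentation by conjugation *)

Theorem corollary5p19 (R : realType) (nu : nat) (S : set 'rV[R]_nu)
    (sigma : 'I_nu -> 'rV[R]_nu) :
  semilattice S ->
  (forall i, S (sigma i)) -> int_basis (int_span S) sigma ->
  let m := ind S sigma in
  ([\/ (m <= nu + 3)%N,
       (nu <= 3)%N /\ m <> 7%N
     | Esupp S sigma = finset.set0] ->
     presentation_by_conjugation S)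
  /\ ((nu <= 3)%N -> (presentation_by_conjugation S <-> m <> 7%N)).
Proof.
move=> slS Ssigma basisS m.
have m_le : (m < 2 ^ nu)%N.
  rewrite /m /ind subn1 prednK; last first.
    by apply/card_gt0P; exists finset.set0; exact: supp0.
  rewrite -[nu in (2 ^ nu)%N]card_ord -cardsT -card_powerset powersetT cardsT.
  exact: max_card.
have cT : #|supp S sigma| = m.+1.
  rewrite /m /ind subn1 prednK //.
  by apply/card_gt0P; exists finset.set0; exact: supp0.
(* For $n\le3$ the bound $k<2^n$ allows $k=7$ only at $n=3$; all other values satisfy $k\le n+3$. *)
have arith n k : (k < 2 ^ n)%N -> (n <= 3)%N ->
    (k = 7%N -> n = 3%N) /\ (k <> 7%N -> (k <= n + 3)%N).
  by case: n => [|[|[|[|//]]]];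
    rewrite ?expn0 ?expn1 -?[(2 ^ 2)%N]/4%N -?[(2 ^ 3)%N]/8%N; lia.
have small : (nu <= 3)%N -> m <> 7%N -> (m <= nu + 3)%N by move=> /(arith _ _ m_le)[].
have present : (m <= nu + 3)%N \/ Esupp S sigma = finset.set0 ->
    presentation_by_conjugation S.
  move=> hyp; have [lam lamE] := dual_basis slS basisS.
  have S0 : S 0 by case: slS.
  have SD s s' : S s -> S s' -> S (s + s' *+ 2) /\ S (s - s' *+ 2).
    by case: slS => _ SD _ _; exact: SD.
  apply: presentation_by_conjugation_inj => // g.
  apply: (@kernel_trivial _ _ _ S sigma lam (supp S sigma)
    (@hat_x _ _ S) (@hat_act _ _ S)) => //.
  - exact: supp_tau.
  - exact: supp_dec.
  - exact: hat_act1.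
  - exact: hat_actM.
  - exact: hat_xx.
  - exact: hat_xJ.
  - exact: hat_ind.
  - exact: acts_hat_x.
  move=> D DT even_D.
  (* [indep] speaks of increasing pairs, the covering lemmas of all distinct pairs. *)
  have eD : evenly_covers D.
    move=> i j; rewrite neq_ltn => /orP[/even_D //|/even_D].
    suff -> : [set P in D | (j \in P) && (i \in P)] =
              [set P in D | (i \in P) && (j \in P)] by [].
    by apply/setP => P; rewrite !inE [(j \in P) && _]andbC.
  case: hyp => [m3|E0].
    apply: (evenly_covers_small (T := supp S sigma)) => //.
    - exact: supp0 slS Ssigma basisS.
    - exact: supp1.
    - by rewrite cT card_ord addnS ltnS.
  apply: (evenly_covers_pairs (T := supp S sigma)) => // P PT.
  rewrite ltnNge; apply/negP => P3.
  have : P \in Esupp S sigma by rewrite finset.inE PT.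
  by rewrite E0 finset.inE.
split=> [[m3|[n3 m7]|E0]|n3]; [by apply: present; left| |by apply: present; right|].
  by apply: present; left; exact: small.
split=> [pres m7|m7]; last by apply: present; left; exact: small.
(* Index 7 forces [nu = 3], and then the eight members of the support are all the subsets. *)
have [/(_ m7) nuE _] := arith _ _ m_le n3.
subst nu; apply: (cube_not_presented slS Ssigma basisS) pres => J.
suff -> : supp S sigma = finset.setT by rewrite inE.
apply/eqP; rewrite eqEcard finset.subsetT cT m7 cardsT.
by rewrite -cardsT -powersetT card_powerset cardsT card_ord.
Qed.
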